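(* For every content $f\in\mathcal{F}$, the integer linear program $\mathrm{SP}_f$ defined in the context can be solved in polynomial time as a shortest path problem. That is, from the data of $\mathrm{SP}_f$ one can construct in polynomial time an instance of a polynomial-time solvable shortest path problem (a directed graph with arc weights, a source and a destination) such that the length of a shortest source-destination path equals the optimal value of $\mathrm{SP}_f$ and an optimal solution of $\mathrm{SP}_f$ can be recovered in polynomial time from a shortest path. Consequently $\mathrm{SP}_f$ can be solved in polynomial time.
   Context: Let $\mathcal{T}=\{1,\dots,T\}$ be the time slots and $\mathcal{F}=\{1,\dots,F\}$ the contents. The following data are given: the size $l_f$ of content $f$; the number $m_{tf}$ of users requesting content $f$ in slot $t$ (for each $t\in\mathcal{T}$); unit downloading costs $c_s>c_b$ (from the server and from the cache, respectively); costs $p_f(i)$ for an age of information (AoI) of $i$ slots ($i=1,\dots,T-1$); a weighting factor $\lambda$; and fixed real (rational) numbers $\pi^*_1,\dots,\pi^*_T$ and $\beta^*_f$ (these are optimal dual values of a linear program, but for the purposes of $\mathrm{SP}_f$ they are just given constants). ''Polynomial time'' means polynomial in the size of this data, which in particular lists the $T$ values $m_{1f},\dots,m_{Tf}$. For a fixed content $f$, the variables are $x_{tf}\in\{0,1\}$ for $t\in\mathcal{T}$ (content $f$ is stored in the cache in slot $t$) and $a_{tfi}\in\{0,1\}$ for $t\in\mathcal{T}$, $i\in\{0,\dots,t-1\}$ (content $f$ is in the cache in slot $t$ with AoI $i$). Let $$C_f=\sum_{t=1}^{T} l_f m_{tf}\left[c_b x_{tf}+c_s(1-x_{tf})\right]+\sum_{t=1}^{T}l_f(c_s-c_b)a_{tf0}+\lambda\sum_{t=1}^{T}\sum_{i=1}^{t-1}p_f(i)m_{tf}a_{tfi}.$$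 $\mathrm{SP}_f$ is the problem $$\min\; C_f-\sum_{t=1}^{T}l_f\pi^*_t x_{tf}-\beta^*_f$$ subject to - $\sum_{i=0}^{t-1}a_{tfi}=x_{tf}$ for $t\in\mathcal{T}$; - $a_{tfi}\ge x_{tf}+a_{(t-1)f(i-1)}-a_{tf0}-1$ for $t\in\mathcal{T}\setminus\{1\}$, $i\in\{1,\dots,t-1\}$; - $a_{tfi}\le a_{(t-1)f(i-1)}$ for $t\in\mathcal{T}\setminus\{1\}$, $i\in\{1,\dots,t-1\}$; - $x_{tf}\in\{0,1\}$ and $a_{tfi}\in\{0,1\}$ for all $t\in\mathcal{T}$, $i\in\{0,\dots,t-1\}$. *)

(* Defs.v *)
From mathcomp Require Import all_boot all_order all_algebra.

Set Implicit Arguments.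
Unset Strict Implicit.
Unset Printing Implicit Defensive.

Import Order.TTheory GRing.Theory Num.Theory.
Local Open Scope ring_scope.

(** * Polynomial-time computability

    The model of computation is a deeply embedded first-order language over
    finite data (naturals, rationals, pairs, sums, lists) whose only iteration
    construct is a traversal of a list.  Running times are bit costs: each node
    of a program is charged, every time it is executed, the bit sizes of its
    whole input and of its whole output.

    The basic operations are computable by a Turing machine in time polynomial
    in that charge, so a program of polynomial cost is a polynomial-time
    algorithm.  Conversely a Turing machine with a polynomial clock is a program
    of polynomial cost: a tape is a pair of lists, and nested list traversals
    provide the clock. *)

Inductive ty : Type :=
| TUnit | TNat | TRat
| TProd of ty & ty
| TSum of ty & ty
| TList of ty.

Definition TBool := TSum TUnit TUnit.

Fixpoint den (a : ty) : Type :=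
  match a with
  | TUnit => unit
  | TNat => nat
  | TRat => rat
  | TProd a b => (den a * den b)%type
  | TSum a b => (den a + den b)%type
  | TList a => seq (den a)
  end.

Definition of_bool (b : bool) : den TBool := if b then inl tt else inr tt.

(* Number of binary digits of n (one digit for n = 0). *)
Definition nbits (n : nat) : nat := (trunc_log 2 n).+1.

Fixpoint bitsize (a : ty) : den a -> nat :=
  match a return den a -> nat with
  | TUnit => fun=> 1%N
  | TNat => nbits
  | TRat => fun q => (nbits `|numq q|%N + nbits `|denq q|%N).+1
  | TProd a b => fun x => (bitsize x.1 + bitsize x.2).+1
  | TSum a b => fun x => match x with
                         | inl y => (bitsize y).+1
                         | inr y => (bitsize y).+1
                         end
  | TList a => fun s => (foldr (fun x n => (bitsize x + n).+1) 1 s)%N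
  end.

Inductive prim : ty -> ty -> Type :=
| NatAdd : prim (TProd TNat TNat) TNat
| NatSub : prim (TProd TNat TNat) TNat
| NatMul : prim (TProd TNat TNat) TNat
| NatLe  : prim (TProd TNat TNat) TBool
| NatRat : prim TNat TRat
| RatAdd : prim (TProd TRat TRat) TRat
| RatOpp : prim TRat TRat
| RatMul : prim (TProd TRat TRat) TRat
| RatInv : prim TRat TRat
| RatLe  : prim (TProd TRat TRat) TBool.

Definition prim_run (a b : ty) (o : prim a b) : den a -> den b :=
  match o in prim a b return den a -> den b with
  | NatAdd => fun x : nat * nat => (x.1 + x.2)%N
  | NatSub => fun x : nat * nat => (x.1 - x.2)%N
  | NatMul => fun x : nat * nat => (x.1 * x.2)%N
  | NatLe  => fun x : nat * nat => of_bool (x.1 <= x.2)%N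
  | NatRat => fun n : nat => n%:R : rat
  | RatAdd => fun x : rat * rat => x.1 + x.2
  | RatOpp => fun x : rat => - x
  | RatMul => fun x : rat * rat => x.1 * x.2
  | RatInv => fun x : rat => x^-1
  | RatLe  => fun x : rat * rat => of_bool (x.1 <= x.2)
  end.

Inductive prog : ty -> ty -> Type :=
| Id a : prog a a
| Comp a b c : prog b c -> prog a b -> prog a c
| Const a b : den b -> prog a b
| Prim a b : prim a b -> prog a b
| Pair a b c : prog a b -> prog a c -> prog a (TProd b c)
| Fst a b : prog (TProd a b) a
| Snd a b : prog (TProd a b) b
| Inl a b : prog a (TSum a b)
| Inr a b : prog b (TSum a b)
| Case a b c d : prog (TProd a b) d -> prog (TProd a c) d ->
                 prog (TProd a (TSum b c)) d
| Cons a : prog (TProd a (TList a)) (TList a)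
| Uncons a : prog (TList a) (TSum TUnit (TProd a (TList a)))
| Fold s a : prog (TProd s a) s -> prog (TProd s (TList a)) s.

Fixpoint run (a b : ty) (p : prog a b) : den a -> den b :=
  match p in prog a b return den a -> den b with
  | Id _ => fun x => x
  | Comp _ _ _ g f => fun x => run g (run f x)
  | Const _ _ v => fun=> v
  | Prim _ _ o => prim_run o
  | Pair _ _ _ f g => fun x => (run f x, run g x)
  | Fst _ _ => fun x => x.1
  | Snd _ _ => fun x => x.2
  | Inl _ _ => fun x => inl x
  | Inr _ _ => fun x => inr x
  | Case _ _ _ _ f g => fun x => match x.2 with
                                 | inl y => run f (x.1, y)
                                 | inr y => run g (x.1, y)
                                 end
  | Cons _ => fun x => x.1 :: x.2
  | Uncons _ => fun s => match s with
                         | [::] => inl tt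
                         | y :: s' => inr (y, s')
                         end
  | Fold _ _ f => fun x => foldl (fun st y => run f (st, y)) x.1 x.2
  end.

Fixpoint cost (a b : ty) (p : prog a b) : den a -> nat := fun x =>
  (bitsize x + bitsize (run p x) +
   match p in prog a b return den a -> nat with
   | Comp _ _ _ g f => fun x => cost f x + cost g (run f x)
   | Pair _ _ _ f g => fun x => cost f x + cost g x
   | Case _ _ _ _ f g => fun x => match x.2 with
                                  | inl y => cost f (x.1, y)
                                  | inr y => cost g (x.1, y)
                                  end
   | Fold _ _ f => fun x =>
       (foldl (fun sc y => (run f (sc.1, y), sc.2 + cost f (sc.1, y)))
              (x.1, 0) x.2).2
   | _ => fun=> 0
   end x)%N.

(* As bitsize x >= 1, the bounds c * bitsize x ^ k are cofinal among
   polynomial bounds. *)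
Definition polytime (a b : ty) (f : den a -> den b) : Prop :=
  exists p : prog a b,
    (forall x, run p x = f x) /\
    exists c k : nat, forall x, (cost p x <= c * bitsize x ^ k)%N.

(** * The shortest path problem *)

(* An arc is (tail, head, weight); parallel arcs are allowed. *)
Definition arc_ty := TProd (TProd TNat TNat) TRat.
Definition arc : Type := (nat * nat * rat)%type.
Definition tail (e : arc) : nat := e.1.1.
Definition head (e : arc) : nat := e.1.2.
Definition weight (e : arc) : rat := e.2.

(* ((vertices, arcs), (source, destination)) *)
Definition graph_ty := TProd (TProd (TList TNat) (TList arc_ty)) (TProd TNat TNat).
Definition graph : Type := ((seq nat * seq arc) * (nat * nat))%type.
Definition vertices (G : graph) : seq nat := G.1.1.
Definition arcs (G : graph) : seq arc := G.1.2.
Definition source (G : graph) : nat := G.2.1.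
Definition destination (G : graph) : nat := G.2.2.

Definition is_graph (G : graph) : Prop :=
  [/\ uniq (vertices G),
      {in arcs G, forall e, (tail e \in vertices G) && (head e \in vertices G)},
      source G \in vertices G & destination G \in vertices G].

Definition pathway_ty := TList arc_ty.
Definition pathway : Type := seq arc.

Fixpoint walk (G : graph) (u : nat) (q : pathway) (v : nat) : bool :=
  match q with
  | [::] => u == v
  | e :: q' => [&& e \in arcs G, tail e == u & walk G (head e) q' v]
  end.

Definition plength (q : pathway) : rat := \sum_(e <- q) weight e.

Definition is_cycle (G : graph) (q : pathway) : Prop :=
  exists u, [/\ q != [::], walk G u q u & uniq (map head q)].

Definition no_negative_cycle (G : graph) : Prop :=
  forall q, is_cycle G q -> 0 <= plength q.

Definition is_sd_path (G : graph) (q : pathway) : Prop :=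
  walk G (source G) q (destination G) /\ uniq (source G :: map head q).

Definition is_shortest_path (G : graph) (q : pathway) : Prop :=
  is_sd_path G q /\ forall q', is_sd_path G q' -> plength q <= plength q'.

(* A correct algorithm for the shortest path problem on digraphs without
   directed cycles of negative length; arc weights may be negative. *)
Definition solves_shortest_path
    (A : den graph_ty -> den (TSum TUnit pathway_ty)) : Prop :=
  forall G : graph, is_graph G -> no_negative_cycle G ->
    match A G with
    | inl _ => forall q, ~ is_sd_path G q
    | inr q => is_shortest_path G q
    end.

(** * The problem SP_f *)

(* Slots are the naturals 1, ..., T and AoIs are 1, ..., T-1; values of the
   functions below outside these ranges are never used. *)
Record caching_data : Type := CachingData {
  T : nat;
  F : nat;
  l : 'I_F -> rat;
  m : nat -> 'I_F -> nat;
  c_s : rat;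
  c_b : rat;
  p : 'I_F -> nat -> rat;
  lambda : rat;
  pi_star : nat -> rat;
  beta_star : 'I_F -> rat;
  T_gt0 : (0 < T)%N;
  c_b_lt_c_s : c_b < c_s
}.

Section SP.

Variables (D : caching_data) (f : 'I_(F D)).

Definition total_cost (x : nat -> rat) (a : nat -> nat -> rat) : rat :=
  \sum_(1 <= t < (T D).+1)
     l f * (m t f)%:R * (c_b D * x t + c_s D * (1 - x t))
  + \sum_(1 <= t < (T D).+1) l f * (c_s D - c_b D) * a t 0%N
  + lambda D *
    \sum_(1 <= t < (T D).+1) \sum_(1 <= i < t) p f i * (m t f)%:R * a t i.

Definition objective (x : nat -> rat) (a : nat -> nat -> rat) : rat :=
  total_cost x a
  - \sum_(1 <= t < (T D).+1) l f * pi_star D t * x t - beta_star f.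

Definition binary (z : rat) : Prop := z = 0 \/ z = 1.

Record feasible (x : nat -> rat) (a : nat -> nat -> rat) : Prop := Feasible {
  one_age : forall t, (1 <= t <= T D)%N -> \sum_(0 <= i < t) a t i = x t;
  ageing : forall t i, (2 <= t <= T D)%N -> (1 <= i <= t.-1)%N ->
    a t i >= x t + a t.-1 i.-1 - a t 0%N - 1;
  no_jump : forall t i, (2 <= t <= T D)%N -> (1 <= i <= t.-1)%N ->
    a t i <= a t.-1 i.-1;
  x_binary : forall t, (1 <= t <= T D)%N -> binary (x t);
  a_binary : forall t i, (1 <= t <= T D)%N -> (i <= t.-1)%N -> binary (a t i)
}.

Definition is_optimal (x : nat -> rat) (a : nat -> nat -> rat) : Prop :=
  feasible x a /\
  forall x' a', feasible x' a' -> objective x a <= objective x' a'.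

Definition is_optimal_value (v : rat) : Prop :=
  (exists x a, feasible x a /\ objective x a = v) /\
  (forall x a, feasible x a -> v <= objective x a).

(* (l_f, (m_tf)_t, (c_s, c_b), (p_f(i))_i, lambda, (pi*_t)_t, beta*_f);
   T is the length of the second component. *)
Definition sp_ty :=
  TProd (TProd (TProd (TProd (TProd (TProd
    TRat (TList TNat)) (TProd TRat TRat)) (TList TRat)) TRat) (TList TRat)) TRat.

Definition sp_data : den sp_ty :=
  (l f,
   [seq m t f | t <- iota 1 (T D)],
   (c_s D, c_b D),
   [seq p f i | i <- iota 1 (T D).-1],
   lambda D,
   [seq pi_star D t | t <- iota 1 (T D)],
   beta_star f).

End SP.

(* A solution is listed as ((x_t)_t, ((a_ti)_i)_t), t = 1..T, i = 0..t-1. *)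
Definition sol_ty := TProd (TList TRat) (TList (TList TRat)).
Definition solution : Type := (seq rat * seq (seq rat))%type.
Definition sol_x (z : solution) (t : nat) : rat := nth 0 z.1 t.-1.
Definition sol_a (z : solution) (t i : nat) : rat := nth 0 (nth [::] z.2 t.-1) i.

(* Main.v *)
From mathcomp Require Import all_boot all_order all_algebra.
From mathcomp Require Import zify ring lra.
Require Import Defs.

(** SP_f chooses a cache state for every slot: "not cached" or "cached with AoI i".
    The constraints say exactly that AoI [i >= 1] in slot [t] requires AoI [i - 1] in slot
    [t - 1], and the objective is a sum of one term per slot which depends only on the
    state in that slot.  So solutions are the source-destination paths of a layered acyclic
    graph whose arcs carry these terms.

    Shortest paths are computed by Bellman-Ford, growing paths backwards from the
    destination.  Every vertex is labelled with an explicit simple path: an arc that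
    would close a cycle is rejected, which loses nothing in the absence of negative
    cycles.  Simple paths keep the labels of polynomial size on every input, which is
    what the cost of the traversals requires. *)

Set Implicit Arguments.
Unset Strict Implicit.
Unset Printing Implicit Defensive.

Import Order.TTheory GRing.Theory Num.Theory.
Local Open Scope nat_scope.

(** * Programs of polynomial cost *)

(** The cost bound has to hold on every input, malformed graphs and data included. All constructs
    except [Fold] preserve polynomial cost; a [Fold] need not, since a body that squares its state
    doubles the number of bits at each step. So each traversal comes with an explicit bound on its
    intermediate states: through [height] for sums of rationals, through [label_ok] and a single
    label per listed vertex for Bellman-Ford. The latter are invariants on any graph, whereas the
    absence of negative cycles enters only into optimality. Naturals cannot drive a loop either:
    every loop is clocked by a list, and T serves as a clock because the requests are listed slot by
    slot. Optimality of the labels after [k] rounds is measured against all walks of at most [k]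
    arcs, which makes the induction on [k] a matter of stripping the first arc. *)

Definition poly_bounded (X : Type) (N g : X -> nat) : Prop :=
  exists c k, forall x, g x <= c * N x ^ k.

Section PolyBounded.
Variables (X : Type) (N : X -> nat).
Hypothesis N_gt0 : forall x, 0 < N x.

Lemma pb_le g h : (forall x, g x <= h x) -> poly_bounded N h -> poly_bounded N g.
Proof. by move=> gh [c [k H]]; exists c, k => x; apply: leq_trans (gh x) (H x). Qed.

Lemma pb_const c : poly_bounded N (fun=> c).
Proof. by exists c, 0 => x; rewrite expn0 muln1. Qed.

Lemma pb_self : poly_bounded N N.
Proof. by exists 1, 1 => x; rewrite expn1 mul1n. Qed.

Lemma pb_add g h :
  poly_bounded N g -> poly_bounded N h -> poly_bounded N (fun x => g x + h x).
Proof.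
move=> [c [k Hg]] [d [j Hh]]; exists (c + d), (k + j) => x; rewrite mulnDl.
apply: leq_add; [apply: leq_trans (Hg x) _|apply: leq_trans (Hh x) _];
  by rewrite leq_mul2l leq_pexp2l ?orbT // ?leq_addr ?leq_addl.
Qed.

Lemma pb_mul g h :
  poly_bounded N g -> poly_bounded N h -> poly_bounded N (fun x => g x * h x).
Proof.
move=> [c [k Hg]] [d [j Hh]]; exists (c * d), (k + j) => x.
by rewrite expnD mulnACA leq_mul.
Qed.

Lemma pb_exp g k : poly_bounded N g -> poly_bounded N (fun x => g x ^ k).
Proof.
move=> Hg; elim: k => [|k IH]; first exact: pb_const.
by apply: (pb_le (h := fun x => g x * g x ^ k)) (pb_mul Hg IH) => x; rewrite expnS.
Qed.

Lemma pb_comp (Y : Type) (M h : Y -> nat) (u : X -> Y) :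
  poly_bounded M h -> poly_bounded N (fun x => M (u x)) ->
  poly_bounded N (fun x => h (u x)).
Proof.
move=> [c [k Hh]] HM; apply: (pb_le (fun x => Hh (u x))).
by apply: pb_mul (pb_const c) (pb_exp _ HM).
Qed.

End PolyBounded.

Lemma bitsize_gt0 a (x : den a) : 0 < bitsize x.
Proof. by case: a x => //= [a b|a] []. Qed.
#[local] Hint Resolve bitsize_gt0 : core.

Arguments bitsize : simpl never.

Lemma bitsize_pair a b (x : den a) (y : den b) :
  @bitsize (TProd a b) (x, y) = (bitsize x + bitsize y).+1.
Proof. by []. Qed.

Lemma bitsize_inl a b (x : den a) : @bitsize (TSum a b) (inl x) = (bitsize x).+1.
Proof. by []. Qed.

Lemma bitsize_inr a b (y : den b) : @bitsize (TSum a b) (inr y) = (bitsize y).+1.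
Proof. by []. Qed.

Lemma bitsize_nil a : @bitsize (TList a) [::] = 1.
Proof. by []. Qed.

Lemma bitsize_cons a (y : den a) (s : den (TList a)) :
  @bitsize (TList a) (y :: s) = (bitsize y + bitsize s).+1.
Proof. by []. Qed.

Definition bitsizeE :=
  (bitsize_pair, bitsize_inl, bitsize_inr, bitsize_nil, bitsize_cons).

Lemma bitsize_cat a (s1 s2 : den (TList a)) :
  (@bitsize (TList a) (s1 ++ s2)).+1 = bitsize s1 + bitsize s2.
Proof. by elim: s1 => [|y s1 IH] //; rewrite cat_cons !bitsize_cons addSn -addnA -IH addnS. Qed.

Lemma bitsize_catl a (s1 s2 : den (TList a)) :
  bitsize s1 <= @bitsize (TList a) (s1 ++ s2).
Proof. by have := bitsize_cat s1 s2; have := bitsize_gt0 s2; lia. Qed.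

Lemma bitsize_rev a (s : den (TList a)) : @bitsize (TList a) (rev s) = bitsize s.
Proof.
elim: s => [|y s IH] //; rewrite rev_cons -cats1 bitsize_cons.
by have := bitsize_cat (rev s) [:: y]; rewrite IH !bitsizeE; lia.
Qed.

Lemma size_bitsize a (s : den (TList a)) : size s < bitsize s.
Proof. by elim: s => [|y s IH] //; rewrite bitsize_cons /=; lia. Qed.

Lemma bitsize_nth a (s : den (TList a)) i d :
  i < size s -> bitsize (nth d s i) < bitsize s.
Proof.
elim: s i => [|y s IH] [|i] // H; rewrite bitsize_cons /=; first lia.
by have := IH i H; lia.
Qed.

(** The cost half of [polytime], stated for a program instead of a function so that it can be
    derived rule by rule along the syntax. *)
Definition ptime a b (p : prog a b) : Prop := poly_bounded (@bitsize a) (cost p).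

(** Every node is charged for its output. A cost bound thus also bounds the size passed on to the
    next program, which is what makes [ptime] stable under composition. *)
Lemma bitsize_run a b (p : prog a b) x : bitsize (run p x) <= cost p x.
Proof. by case: p x => *; rewrite /cost -/cost; lia. Qed.

Lemma pb_run a b (p : prog a b) :
  ptime p -> poly_bounded (@bitsize a) (fun x => bitsize (run p x)).
Proof. by apply: pb_le => x; apply: bitsize_run. Qed.

Ltac pb := repeat first
  [ assumption | exact: pb_self | apply: pb_const | apply: pb_add => //
  | apply: pb_mul => // | apply: pb_exp => // | apply: pb_run ].

Lemma pt_Id a : ptime (Id a).
Proof. by apply: (pb_le (h := fun x => bitsize x + bitsize x)); [move=> x /=; lia|pb]. Qed.

Lemma pt_Comp a b c (g : prog b c) (f : prog a b) :
  ptime g -> ptime f -> ptime (Comp g f).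
Proof.
move=> Hg Hf.
have Hgf : poly_bounded (@bitsize a) (fun x => cost g (run f x)).
  by apply: pb_comp Hg _ => //; pb.
apply: (pb_le (h := fun x => bitsize x + cost g (run f x)
   + (cost f x + cost g (run f x)))); last by pb.
by move=> x /=; have := bitsize_run g (run f x); lia.
Qed.

Lemma pt_Const a b (v : den b) : ptime (@Const a b v).
Proof. by apply: (pb_le (h := fun x => bitsize x + bitsize v)); [move=> x /=; lia|pb]. Qed.

Lemma pt_Pair a b c (f : prog a b) (g : prog a c) :
  ptime f -> ptime g -> ptime (Pair f g).
Proof.
move=> Hf Hg; apply: (pb_le (h := fun x => bitsize x + (cost f x + cost g x + 1)
   + (cost f x + cost g x))); last by pb.
by move=> x /=; rewrite bitsize_pair; have := bitsize_run f x; have := bitsize_run g x; lia.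
Qed.

Lemma pt_le1 a b (p : prog a b) :
  (forall x, cost p x <= bitsize x + bitsize (run p x)) ->
  (forall x, bitsize (run p x) <= 3 * bitsize x + 3) -> ptime p.
Proof.
move=> H1 H2; apply: (pb_le (h := fun x => 4 * bitsize x + 3)); last by pb.
by move=> x; have := H1 x; have := H2 x; lia.
Qed.

Lemma pt_Fst a b : ptime (Fst a b).
Proof. by apply: pt_le1 => -[x y] /=; rewrite ?bitsizeE; lia. Qed.

Lemma pt_Snd a b : ptime (Snd a b).
Proof. by apply: pt_le1 => -[x y] /=; rewrite ?bitsizeE; lia. Qed.

Lemma pt_Inl a b : ptime (Inl a b).
Proof. by apply: pt_le1 => x /=; rewrite ?bitsizeE; lia. Qed.

Lemma pt_Inr a b : ptime (Inr a b).
Proof. by apply: pt_le1 => x /=; rewrite ?bitsizeE; lia. Qed.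

Lemma pt_Cons a : ptime (Cons a).
Proof. by apply: pt_le1 => -[x y] /=; rewrite ?bitsizeE; lia. Qed.

Lemma pt_Uncons a : ptime (Uncons a).
Proof.
apply: pt_le1 => [x|]; first by rewrite /= addn0.
have H (y : den a) (s : den (TList a)) :
  (bitsize y + bitsize s).+2 <= 3 * (bitsize y + bitsize s).+1 + 3 by lia.
by case=> [|y s] //; apply: H.
Qed.

Lemma leq_exp m n k : m <= n -> m ^ k <= n ^ k.
Proof. by case: k => [|k] H; rewrite ?expn0 ?leq_exp2r. Qed.

(** Each branch runs only under its own tag, so its cost is no function of the whole input to which
    [pb_comp] could apply. The two bounds are opened and added instead; a branch reads [(x, y)],
    which is one smaller than the tagged pair. *)
Lemma pt_Case a b c d (f : prog (TProd a b) d) (g : prog (TProd a c) d) :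
  ptime f -> ptime g -> ptime (Case f g).
Proof.
move=> [c1 [k1 H1]] [c2 [k2 H2]].
apply: (pb_le (h := fun x => bitsize x + (c1 * bitsize x ^ k1 + c2 * bitsize x ^ k2)
   + (c1 * bitsize x ^ k1 + c2 * bitsize x ^ k2))); last by pb.
move=> [x [y|y]]; rewrite /= !bitsizeE.
  have L : c1 * (bitsize x + bitsize y).+1 ^ k1
           <= c1 * (bitsize x + (bitsize y).+1).+1 ^ k1.
    by rewrite leq_mul2l leq_exp ?orbT //; lia.
  by have := H1 (x, y); have := bitsize_run f (x, y); rewrite !bitsizeE; lia.
have L : c2 * (bitsize x + bitsize y).+1 ^ k2
         <= c2 * (bitsize x + (bitsize y).+1).+1 ^ k2.
  by rewrite leq_mul2l leq_exp ?orbT //; lia.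
by have := H2 (x, y); have := bitsize_run g (x, y); rewrite !bitsizeE; lia.
Qed.

(** [B] has to bound the body only at states that the traversal reaches; these are indexed by the
    prefix [l1] already consumed. *)
Lemma cost_foldl s a (f : prog (TProd s a) s) B (st : den s)
    (l : den (TList a)) n :
  (forall (l1 : den (TList a)) (y : den a) (l2 : den (TList a)), l = l1 ++ y :: l2 ->
     cost f (foldl (fun (st : den s) (y : den a) => run f (st, y)) st l1, y) <= B) ->
  (foldl (fun (sc : den s * nat) (y : den a) => (run f (sc.1, y), sc.2 + cost f (sc.1, y))) (st, n) l).2
    <= n + size l * B.
Proof.
elim: l st n => [|y l IH] st n H /=; first by rewrite addn0.
apply: leq_trans (IH _ _ _) _ => [l1 z l2 E|].
  by apply: (H (y :: l1) z l2); rewrite E.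
by rewrite mulSn; have := H [::] y l erefl; move=> /=; lia.
Qed.

(* [Fold f] alone need not be polynomial for arbitrary initial states: the
   size of the intermediate states is only controlled along [init]. *)
Lemma pt_Fold x s a (f : prog (TProd s a) s) (init : prog x (TProd s (TList a)))
    (S : den x -> nat) :
  ptime f -> ptime init -> poly_bounded (@bitsize x) S ->
  (forall z (l1 l2 : den (TList a)), (run init z).2 = l1 ++ l2 ->
     bitsize (foldl (fun (st : den s) (y : den a) => run f (st, y)) (run init z).1 l1)
       <= S z) ->
  ptime (Comp (Fold f) init).
Proof.
move=> [c [k Hf]] Hi HS H.
(* One call of [f] reads a state of size at most [S z] and a list entry, which is part of the output
   of [init]. The number of calls is also below [cost init z]. *)
pose B z := c * (S z + cost init z + 1) ^ k.
apply: (pb_le (h := fun z => bitsize z + S z + (cost init z +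
  (cost init z + S z + cost init z * B z)))); last by pb.
move=> z /=.
have H0 := H z (run init z).2 [::]; rewrite cats0 in H0.
have {}H0 := H0 erefl.
have Hr := bitsize_run init z.
have Ez : bitsize (run init z) =
  (@bitsize s (run init z).1 + @bitsize (TList a) (run init z).2).+1 by [].
have Hc := @cost_foldl _ _ f (B z) (run init z).1 (run init z).2 0.
move: Hc; rewrite add0n => Hc.
apply: leq_add; first by rewrite leq_add2l.
rewrite leq_add2l; apply: leq_add; first by apply: leq_add.
apply: leq_trans (Hc _) _ => [l1 y l2 E|]; last first.
  by rewrite leq_mul2r; have := @size_bitsize a (run init z).2; lia.
apply: leq_trans (Hf _) _; rewrite leq_mul2l leq_exp ?orbT //=.
have HS1 := H z l1 (y :: l2) E.
by have := bitsize_cat l1 (y :: l2); rewrite -E !bitsizeE; lia.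
Qed.

(** * Growth of bit sizes under arithmetic *)

Lemma nbits_le n k : 0 < k -> n < 2 ^ k -> nbits n <= k.
Proof.
case: n => [|n] k0 H; first by rewrite /nbits trunc_log0.
by rewrite /nbits -(ltn_exp2l _ _ (ltnSn 1)); apply: leq_ltn_trans (trunc_logP _ _) H.
Qed.

Lemma ltn_nbits n : n < 2 ^ nbits n.
Proof. exact: trunc_log_ltn. Qed.

Lemma nbits_mul m n : nbits (m * n) <= nbits m + nbits n.
Proof. by apply: nbits_le => //; rewrite expnD; apply: ltn_mul; apply: ltn_nbits. Qed.

Lemma nbits_mono m n : m <= n -> nbits m <= nbits n.
Proof. by move=> H; apply: nbits_le => //; apply: leq_ltn_trans H (ltn_nbits n). Qed.

Lemma nbits_add m n : nbits (m + n) <= nbits m + nbits n.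
Proof.
apply: nbits_le => //; rewrite expnD.
have := ltn_nbits m; have := ltn_nbits n.
(* Numbers that are at least 2 have a sum bounded by their product. *)
have : 2 <= 2 ^ nbits m by rewrite /nbits expnS leq_pmulr ?expn_gt0.
have : 2 <= 2 ^ nbits n by rewrite /nbits expnS leq_pmulr ?expn_gt0.
nia.
Qed.

Lemma nbits_succ n : nbits n.+1 <= (nbits n).+1.
Proof. by apply: nbits_le => //; rewrite expnS; have := ltn_nbits n; lia. Qed.

Lemma nbits_leS n : nbits n <= n.+1.
Proof. by elim: n => // n IH; apply: leq_trans (nbits_succ n) _. Qed.

Lemma bitsize_nat n : @bitsize TNat n = nbits n.
Proof. by []. Qed.

Lemma bitsize_bool b : @bitsize TBool (of_bool b) = 2.
Proof. by case: b. Qed.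

(* Submultiplicative under both addition and multiplication, so its bit size
   grows only additively along sums, unlike that of the numerator alone. *)
Definition height (q : rat) : nat := `|numq q| + `|denq q|.

(** Reducing the fraction divides [n] and [d] by a common nonzero factor [k], which cannot increase
    their absolute values. *)
Lemma height_div (n d : int) : d != 0%R ->
  height (n%:~R / d%:~R) <= `|n| + `|d|.
Proof.
move=> d0; case: (divqP n d) => [E|k x k0]; first by rewrite E eqxx in d0.
by rewrite /height !abszM -mulnDr leq_pmull // absz_gt0.
Qed.

(** For [x = a/b] and [y = c/d], the height of [(ad + cb)/(bd)] is at most [|ad| + |cb| + |bd|],
    three of the four terms of [(|a| + |b|)(|c| + |d|)]. *)
Lemma heightD x y : height (x + y)%R <= height x * height y.
Proof.
rewrite -{1}[x]divq_num_den -{1}[y]divq_num_den addf_div ?intr_eq0 ?denq_neq0 //.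
rewrite -!intrM -intrD; apply: leq_trans (height_div _ _) _.
  by rewrite mulf_neq0 ?denq_neq0.
rewrite /height abszM.
have abszD (a b : int) : `|(a + b)%R| <= `|a| + `|b| by lia.
by apply: leq_trans (leq_add (abszD _ _) (leqnn _)) _; rewrite !abszM; nia.
Qed.

Lemma heightM x y : height (x * y)%R <= height x * height y.
Proof.
rewrite -{1}[x]divq_num_den -{1}[y]divq_num_den mulf_div.
rewrite -!intrM; apply: leq_trans (height_div _ _) _.
  by rewrite mulf_neq0 ?denq_neq0.
rewrite /height !abszM; nia.
Qed.

Lemma bitsize_rat_le q : @bitsize TRat q <= 2 * nbits (height q) + 1.
Proof.
have := @nbits_mono `|numq q| (height q) (leq_addr _ _).
have := @nbits_mono `|denq q| (height q) (leq_addl _ _).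
by change (@bitsize TRat q) with (nbits `|numq q| + nbits `|denq q|).+1; lia.
Qed.

Lemma nbits_height q : nbits (height q) < @bitsize TRat q.
Proof. exact: nbits_add. Qed.

Lemma pt_prim a b (o : prim a b) :
  (forall x, bitsize (prim_run o x) <= 3 * bitsize x + 3) -> ptime (Prim o).
Proof. by move=> H; apply: pt_le1 => // x; rewrite /= addn0. Qed.

Lemma pt_NatAdd : ptime (Prim NatAdd).
Proof.
apply: pt_prim => -[m n]; rewrite bitsizeE !bitsize_nat.
by have := nbits_add m n; move=> /=; lia.
Qed.

Lemma pt_NatSub : ptime (Prim NatSub).
Proof.
apply: pt_prim => -[m n]; rewrite bitsizeE !bitsize_nat.
by have := nbits_mono (leq_subr n m); move=> /=; lia.
Qed.

Lemma pt_NatMul : ptime (Prim NatMul).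
Proof.
apply: pt_prim => -[m n]; rewrite bitsizeE !bitsize_nat.
by have := nbits_mul m n; move=> /=; lia.
Qed.

Lemma pt_NatLe : ptime (Prim NatLe).
Proof. by apply: pt_prim => x; rewrite bitsize_bool; lia. Qed.

Lemma pt_RatLe : ptime (Prim RatLe).
Proof. by apply: pt_prim => x; rewrite bitsize_bool; lia. Qed.

Lemma pt_NatRat : ptime (Prim NatRat).
Proof.
apply: pt_prim => n; rewrite bitsize_nat.
rewrite -[bitsize (prim_run _ _)]
  /(nbits `|numq (n%:Z)%:Q%R| + nbits `|denq (n%:Z)%:Q%R|).+1.
by rewrite numq_int denq_int /= {2}/nbits trunc_log1; lia.
Qed.

Lemma pt_RatOpp : ptime (Prim RatOpp).
Proof.
apply: pt_prim => q; rewrite -[bitsize (prim_run _ _)]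
  /(nbits `|numq (- (q : rat))%R| + nbits `|denq (- (q : rat))%R|).+1.
rewrite numqN denqN abszN.
by change (@bitsize TRat q) with (nbits `|numq q| + nbits `|denq q|).+1; lia.
Qed.

Lemma pt_RatAdd : ptime (Prim RatAdd).
Proof.
apply: pt_prim => -[x y]; rewrite bitsizeE /=; apply: leq_trans (bitsize_rat_le _) _.
have := nbits_mono (heightD x y); have := nbits_mul (height x) (height y).
have := nbits_height x; have := nbits_height y; lia.
Qed.

Lemma pt_RatMul : ptime (Prim RatMul).
Proof.
apply: pt_prim => -[x y]; rewrite bitsizeE /=; apply: leq_trans (bitsize_rat_le _) _.
have := nbits_mono (heightM x y); have := nbits_mul (height x) (height y).
have := nbits_height x; have := nbits_height y; lia.
Qed.

#[local] Hint Resolve pt_Id pt_Const pt_Fst pt_Snd pt_Inl pt_Inr pt_Cons pt_Uncons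
  pt_NatAdd pt_NatSub pt_NatMul pt_NatLe pt_NatRat pt_RatAdd pt_RatOpp pt_RatMul
  pt_RatLe : ptime.
#[local] Hint Resolve pt_Comp pt_Pair pt_Case : ptime.
#[local] Hint Constants Transparent : ptime.
#[local] Hint Opaque ptime : ptime.
Ltac ptime := solve [eauto 500 with ptime nocore].

(** * Derived programs: arithmetic, tests and list operations *)

Arguments run : simpl never.
Arguments cost : simpl never.
Arguments Id {a}.
Arguments Const {a b}.
Arguments Fst {a b}.
Arguments Snd {a b}.
Arguments Inl {a b}.
Arguments Inr {a b}.
Arguments Cons {a}.
Arguments Uncons {a}.
Notation "g <<< f" := (Comp g f) (at level 45, right associativity).
Notation "<( f , g )>" := (Pair f g) (at level 0, f at level 99, g at level 99).

Section RunE.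
Variables a b c d : ty.

Lemma run_Id (x : den a) : run Id x = x. Proof. by []. Qed.
Lemma run_Comp (g : prog b c) (f : prog a b) x : run (g <<< f) x = run g (run f x).
Proof. by []. Qed.
Lemma run_Const (v : den b) (x : den a) : run (Const v) x = v. Proof. by []. Qed.
Lemma run_Pair (f : prog a b) (g : prog a c) x :
  run <(f, g)> x = (run f x, run g x) :> den (TProd b c).
Proof. by []. Qed.
Lemma run_Fst (x : den (TProd a b)) : run Fst x = x.1. Proof. by []. Qed.
Lemma run_Snd (x : den (TProd a b)) : run Snd x = x.2. Proof. by []. Qed.
Lemma run_Cons (x : den (TProd a (TList a))) : run Cons x = x.1 :: x.2.
Proof. by []. Qed.
End RunE.

Notation NatC n := (@Const _ TNat n).
Notation RatC q := (@Const _ TRat q).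

Section Arithmetic.
Variable x : ty.
Implicit Types (f g : prog x TNat) (u v : prog x TRat) (z : den x).

Definition NAdd f g := Prim NatAdd <<< <(f, g)>.
Definition NSub f g := Prim NatSub <<< <(f, g)>.
Definition NMul f g := Prim NatMul <<< <(f, g)>.
Definition RNat f := Prim NatRat <<< f.
Definition RAdd u v := Prim RatAdd <<< <(u, v)>.
Definition RMul u v := Prim RatMul <<< <(u, v)>.
Definition ROpp u := Prim RatOpp <<< u.

Lemma run_NAdd f g z : run (NAdd f g) z = run f z + run g z. Proof. by []. Qed.
Lemma run_NSub f g z : run (NSub f g) z = run f z - run g z. Proof. by []. Qed.
Lemma run_NMul f g z : run (NMul f g) z = run f z * run g z. Proof. by []. Qed.
Lemma run_RNat f z : run (RNat f) z = (run f z)%:R%R. Proof. by []. Qed.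
Lemma run_RAdd u v z : run (RAdd u v) z = (run u z + run v z :> rat)%R.
Proof. by []. Qed.
Lemma run_RMul u v z : run (RMul u v) z = (run u z * run v z :> rat)%R.
Proof. by []. Qed.
Lemma run_ROpp u z : run (ROpp u) z = (- run u z :> rat)%R. Proof. by []. Qed.

End Arithmetic.

(* The arithmetic rules come first: their programs are also compositions. *)
Definition runE := (run_NAdd, run_NSub, run_NMul, run_RNat, run_RAdd, run_RMul,
  run_ROpp, run_Id, run_Comp, run_Const, run_Pair, run_Fst, run_Snd, run_Cons).

(* Destructs a pair while keeping its components typed by [den]. *)
Lemma den_pair_ind a b (P : den (TProd a b) -> Prop) :
  (forall (x : den a) (y : den b), P (x, y)) -> forall z, P z.
Proof. by move=> H []. Qed.

Definition holds (v : den TBool) : bool := if v is inl _ then true else false.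

Lemma of_boolK b : holds (of_bool b) = b. Proof. by case: b. Qed.

Definition Match x a b c (e : prog x (TSum a b)) (f : prog (TProd x a) c)
  (g : prog (TProd x b) c) : prog x c := Case f g <<< <(Id, e)>.

(* Derived programs are [locked], so that rewriting with [runE] does not unfold them. *)
Definition If x a (e : prog x TBool) (f g : prog x a) : prog x a :=
  locked (Match e (f <<< Fst) (g <<< Fst)).

Lemma run_If x a (e : prog x TBool) (f g : prog x a) z :
  run (If e f g) z = if holds (run e z) then run f z else run g z.
Proof.
rewrite /If -lock; have H (v : unit + unit) : @run (TProd x TBool) a (Case (f <<< Fst) (g <<< Fst)) (z, v)
    = if holds v then run f z else run g z by case: v.
exact: H.
Qed.

Lemma pt_If x a (e : prog x TBool) (f g : prog x a) :
  ptime e -> ptime f -> ptime g -> ptime (If e f g).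
Proof. by move=> *; rewrite /If -lock /Match; ptime. Qed.
#[local] Hint Resolve pt_If : ptime.

Definition Bool {x} (b : bool) : prog x TBool := Const (of_bool b).
Definition And x (p q : prog x TBool) : prog x TBool :=
  locked (If p q (Bool false)).
Definition Or x (p q : prog x TBool) : prog x TBool :=
  locked (If p (Bool true) q).
Definition Not x (p : prog x TBool) : prog x TBool :=
  locked (If p (Bool false) (Bool true)).
Definition Leq x (p q : prog x TNat) : prog x TBool :=
  locked (Prim NatLe <<< <(p, q)>).
Definition Eqn x (p q : prog x TNat) : prog x TBool :=
  locked (And (Leq p q) (Leq q p)).

Section Bool.
Variable x : ty.
Implicit Types (p q : prog x TBool) (u v : prog x TNat) (z : den x).

Lemma holds_And p q z : holds (run (And p q) z) = holds (run p z) && holds (run q z).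
Proof. by rewrite /And -lock run_If; case: ifP. Qed.

Lemma holds_Or p q z : holds (run (Or p q) z) = holds (run p z) || holds (run q z).
Proof. by rewrite /Or -lock run_If; case: ifP. Qed.

Lemma holds_Not p z : holds (run (Not p) z) = ~~ holds (run p z).
Proof. by rewrite /Not -lock run_If; case: ifP. Qed.

Lemma holds_Leq u v z : holds (run (Leq u v) z) = ((run u z : nat) <= run v z).
Proof. by rewrite /Leq -lock; exact: of_boolK. Qed.

Lemma holds_Eqn u v z : holds (run (Eqn u v) z) = (run u z == run v z :> nat).
Proof. by rewrite /Eqn -lock holds_And !holds_Leq eqn_leq. Qed.

Lemma pt_And p q : ptime p -> ptime q -> ptime (And p q).
Proof. by move=> *; rewrite /And -lock /Bool; ptime. Qed.
Lemma pt_Or p q : ptime p -> ptime q -> ptime (Or p q).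
Proof. by move=> *; rewrite /Or -lock /Bool; ptime. Qed.
Lemma pt_Not p : ptime p -> ptime (Not p).
Proof. by move=> *; rewrite /Not -lock /Bool; ptime. Qed.
Lemma pt_Leq u v : ptime u -> ptime v -> ptime (Leq u v).
Proof. by move=> *; rewrite /Leq -lock; ptime. Qed.
Lemma pt_Eqn u v : ptime u -> ptime v -> ptime (Eqn u v).
Proof. by move=> *; rewrite /Eqn -lock; apply: pt_And; apply: pt_Leq. Qed.

End Bool.
#[local] Hint Resolve pt_And pt_Or pt_Not pt_Leq pt_Eqn : ptime.
Definition holdsE := (holds_And, holds_Or, holds_Not, holds_Leq, holds_Eqn).

(** A traversal can only push onto the front of the list in its state, so reversing onto another
    list is the natural primitive; [Rev], [Cat] and [Map] are built on it. *)
Definition CatRev a : prog (TProd (TList a) (TList a)) (TList a) :=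
  locked (Fold (Cons <<< <(Snd, Fst)>) <<< Id).

Lemma foldl_Cons a (s l : den (TList a)) :
  foldl (fun (st : den (TList a)) (y : den a) => run (Cons <<< <(Snd, Fst)>) (st, y)) s l
  = catrev l s.
Proof. by elim: l s => //= y l IH s; rewrite !runE IH. Qed.

Lemma run_CatRev a (s1 s2 : den (TList a)) : run (@CatRev a) (s1, s2) = catrev s2 s1.
Proof. by rewrite /CatRev -lock; exact: foldl_Cons. Qed.

Lemma bitsize_catrev a (s t : den (TList a)) :
  @bitsize (TList a) (catrev s t) <= bitsize s + bitsize t.
Proof. by have := bitsize_cat (rev s) t; rewrite catrevE bitsize_rev; lia. Qed.

Lemma pt_CatRev a : ptime (@CatRev a).
Proof.
rewrite /CatRev -lock.
apply: (@pt_Fold _ _ _ _ _ (fun x => bitsize x)); [ptime|ptime|pb|].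
move=> [s t] l1 l2; rewrite !run_Id => E; have {}E : t = l1 ++ l2 by [].
rewrite [(_, _).1]/= foldl_Cons.
apply: leq_trans (bitsize_catrev _ _) _; rewrite bitsize_pair E.
by have := bitsize_catl l1 l2; lia.
Qed.
#[local] Hint Resolve pt_CatRev : ptime.

Definition Nil {x} a : prog x (TList a) := @Const x (TList a) [::].

Definition Rev a : prog (TList a) (TList a) :=
  locked (@CatRev a <<< <(Nil a, Id)>).
Lemma run_Rev a (s : den (TList a)) : run (@Rev a) s = rev s.
Proof. by rewrite /Rev -lock /Nil !runE run_CatRev. Qed.
Lemma pt_Rev a : ptime (@Rev a). Proof. by rewrite /Rev -lock /Nil; ptime. Qed.
#[local] Hint Resolve pt_Rev : ptime.

Definition Cat a : prog (TProd (TList a) (TList a)) (TList a) :=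
  locked (@CatRev a <<< <(Snd, @Rev a <<< Fst)>).
Lemma run_Cat a (s t : den (TList a)) : run (@Cat a) (s, t) = s ++ t.
Proof. by rewrite /Cat -lock !runE run_CatRev run_Rev catrevE revK. Qed.
Lemma pt_Cat a : ptime (@Cat a). Proof. by rewrite /Cat -lock; ptime. Qed.
#[local] Hint Resolve pt_Cat : ptime.

Definition Flatten a : prog (TList (TList a)) (TList a) :=
  locked (Fold (@Cat a <<< <(Snd, Fst)>) <<< <(Nil a, @Rev (TList a))>).

Lemma run_Flatten a (ss : seq (den (TList a))) : run (@Flatten a) ss = flatten ss.
Proof.
rewrite /Flatten -lock !runE run_Rev -[RHS]/(foldr (fun s t => s ++ t) [::] ss) -foldl_rev.
rewrite -[run (Fold _) _]/(foldl (fun (st : den (TList a)) (y : den (TList a)) =>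
  run (@Cat a <<< <(Snd, Fst)>) (st, y)) [::] (rev ss)).
elim: (rev ss) [::] => //= s {}ss IH t.
by rewrite !runE run_Cat IH.
Qed.

Lemma pt_Flatten a : ptime (@Flatten a).
Proof.
rewrite /Flatten -lock.
apply: (@pt_Fold _ _ _ _ _ (fun x => 1 + bitsize x)); [ptime|rewrite /Nil; ptime|pb|].
move=> ss l1 l2; rewrite runE run_Rev => E; have {}E : rev ss = l1 ++ l2 by [].
have H (s : den (TList a)) (l : den (TList (TList a))) :
  bitsize (foldl (fun (st : den (TList a)) (y : den (TList a)) =>
    run (@Cat a <<< <(Snd, Fst)>) (st, y)) s l) <= bitsize s + bitsize l.
  elim: l s => [|y l IH] s; first by rewrite /= leq_addr.
  apply: leq_trans (IH _) _; rewrite bitsize_cons !runE /= run_Cat.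
  by have := bitsize_cat y s; lia.
apply: leq_trans (H _ _) _; rewrite bitsize_nil leq_add2l -(bitsize_rev ss) E.
exact: bitsize_catl.
Qed.
#[local] Hint Resolve pt_Flatten : ptime.

Section Map.
Variables (e a b : ty) (f : prog (TProd e a) b).

(** The language has no closures: the environment of the body travels in the state, next to the
    output. [Map] traverses the reversed list, so that pushing restores the order. *)
Definition MapStep : prog (TProd (TProd e (TList b)) a) (TProd e (TList b)) :=
  <(Fst <<< Fst, Cons <<< <(f <<< <(Fst <<< Fst, Snd)>, Snd <<< Fst)>)>.

Definition Map : prog (TProd e (TList a)) (TList b) :=
  locked (Snd <<< Fold MapStep <<< <(<(Fst, Nil b)>, @Rev a <<< Snd)>).

Lemma foldl_MapStep (z : den e) (s : den (TList b)) (l : den (TList a)) :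
  foldl (fun (st : den (TProd e (TList b))) (y : den a) => run MapStep (st, y)) (z, s) l
  = (z, catrev [seq run f (z, y) | y <- l] s).
Proof. by elim: l s => //= y l IH s; rewrite /MapStep !runE IH. Qed.

Lemma run_Map (z : den e) (l : den (TList a)) :
  run Map (z, l) = [seq run f (z, y) | y <- l].
Proof.
rewrite /Map -lock !runE run_Rev.
rewrite -[run (Fold _) _]/(foldl (fun (st : den (TProd e (TList b))) (y : den a) =>
  run MapStep (st, y)) (z, [::]) (rev l)).
by rewrite foldl_MapStep /= map_rev -[catrev _ _]/(rev _) revK.
Qed.

Lemma bitsize_map (g : den a -> den b) (l : den (TList a)) M :
  (forall y, bitsize y <= bitsize l -> bitsize (g y) <= M) ->
  @bitsize (TList b) [seq g y | y <- l] <= size l * M.+1 + 1.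
Proof.
have: bitsize l <= bitsize l by [].
(* The size bound on the entries is frozen as [K], because [l] shrinks during the induction. *)
move: {2 3}(bitsize l) => K; elim: l => [|y l IH] //=; rewrite !bitsize_cons => H Hg.
have := Hg y; have := IH _ Hg; rewrite mulSn; lia.
Qed.

Lemma pt_Map : ptime f -> ptime Map.
Proof.
move=> Hf; rewrite /Map -lock; apply: pt_Comp (pt_Snd _ _) _.
case: (Hf) => c [k Hc].
apply: (@pt_Fold _ _ _ _ _
  (* The environment, plus at most [bitsize x] outputs, each no larger than the cost bound
     [c * bitsize x ^ k] of the body. *)
  (fun x => bitsize x + (bitsize x * (c * (bitsize x) ^ k).+1 + 1) + 1)).
- by rewrite /MapStep; ptime.
- by rewrite /Nil; ptime.
- pb; apply: (pb_le (h := fun x => c * bitsize x ^ k + 1)) => [x|]; first by rewrite addn1.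
  by pb.
elim/den_pair_ind=> z l l1 l2; rewrite !runE /= run_Rev => E; have {}E : rev l = l1 ++ l2 by [].
have El : bitsize l1 <= bitsize l by rewrite -(bitsize_rev l) E bitsize_catl.
rewrite foldl_MapStep !bitsize_pair -/(rev _) bitsize_rev.
set W := c * _ ^ k.
have B y : bitsize y <= bitsize l1 -> bitsize (run f (z, y)) <= W.
  move=> Hy; apply: leq_trans (bitsize_run _ _) (leq_trans (Hc _) _).
  by rewrite leq_mul2l leq_exp ?orbT // !bitsize_pair; lia.
have := bitsize_map B.
have : size l1 * W.+1 <= (bitsize z + bitsize l).+1 * W.+1.
  by rewrite leq_mul2r; have := size_bitsize l1; lia.
move: W {B} => W; set M := @bitsize (TList b) _; lia.
Qed.

End Map.
#[local] Hint Resolve pt_Map : ptime.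

Definition Filter e a (p : prog (TProd e a) TBool) : prog (TProd e (TList a)) (TList a) :=
  locked (@Flatten a <<< Map (If p (Cons <<< <(Snd, Nil a)>) (Nil a))).

Lemma run_Filter e a (p : prog (TProd e a) TBool) (z : den e) (l : den (TList a)) :
  run (Filter p) (z, l) = [seq y <- l | holds (run p (z, y))].
Proof.
rewrite /Filter -lock runE run_Map run_Flatten; elim: l => //= y l ->.
by rewrite run_If; case: ifP.
Qed.

Lemma pt_Filter e a (p : prog (TProd e a) TBool) : ptime p -> ptime (Filter p).
Proof. by move=> *; rewrite /Filter -lock /Nil; ptime. Qed.
#[local] Hint Resolve pt_Filter : ptime.

Definition Has e a (p : prog (TProd e a) TBool) : prog (TProd e (TList a)) TBool :=
  locked (Match (Uncons <<< Filter p) (Bool false) (Bool true)).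

Lemma holds_Has e a (p : prog (TProd e a) TBool) (z : den e) (l : den (TList a)) :
  holds (run (Has p) (z, l)) = has (fun y => holds (run p (z, y))) l.
Proof.
rewrite has_count -size_filter -run_Filter /Has -lock /Match !runE.
have H (s : den (TList a)) :
  holds (@run (TProd (TProd e (TList a)) (TSum TUnit (TProd a (TList a)))) TBool
    (Case (Bool false) (Bool true)) ((z, l), run (@Uncons a) s)) = (0 < size s).
  by case: s.
exact: H.
Qed.

Lemma pt_Has e a (p : prog (TProd e a) TBool) : ptime p -> ptime (Has p).
Proof. by move=> *; rewrite /Has -lock /Match /Bool; ptime. Qed.
#[local] Hint Resolve pt_Has : ptime.

Definition Mem : prog (TProd TNat (TList TNat)) TBool :=
  locked (Has (Eqn Fst Snd)).
Lemma holds_Mem (n : nat) (s : seq nat) : holds (run Mem (n, s)) = (n \in s).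
Proof.
rewrite /Mem -lock holds_Has -has_pred1; apply: eq_has => m.
by rewrite holds_Eqn !runE eq_sym.
Qed.
Lemma pt_Mem : ptime Mem. Proof. by rewrite /Mem -lock; ptime. Qed.
#[local] Hint Resolve pt_Mem : ptime.

Definition Take1 a : prog (TList a) (TList a) :=
  locked (Match Uncons (Nil a) (Cons <<< <(Fst <<< Snd, Nil a)>)).
Lemma run_Take1 a (s : den (TList a)) : run (@Take1 a) s = take 1 s.
Proof.
rewrite /Take1 -lock; have H (y : den a) (t : den (TList a)) : [:: y] = take 1 (y :: t).
  by rewrite /= take0.
by case: s => // y s; apply: H.
Qed.
Lemma pt_Take1 a : ptime (@Take1 a).
Proof. by rewrite /Take1 -lock /Match /Nil; ptime. Qed.
#[local] Hint Resolve pt_Take1 : ptime.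

Definition Pairs a b : prog (TProd (TList a) (TList b)) (TList (TProd a b)) :=
  locked (@Flatten (TProd a b) <<< Map (Map Id <<< <(Snd, Fst)>) <<< <(Snd, Fst)>).
Lemma run_Pairs a b (s : den (TList a)) (t : den (TList b)) :
  run (@Pairs a b) (s, t) = [seq (x, y) | x <- s, y <- t].
Proof.
rewrite /Pairs -lock !runE run_Map run_Flatten; congr flatten; apply: eq_map => x.
by rewrite !runE run_Map.
Qed.
Lemma pt_Pairs a b : ptime (@Pairs a b).
Proof. by rewrite /Pairs -lock; ptime. Qed.
#[local] Hint Resolve pt_Pairs : ptime.

(** A counter is driven by the entries of a list, whose values are ignored. The state also collects
    the indices met so far, latest first; they stay polynomial because they are below the length of
    the list. *)
Definition CountStep a : prog (TProd (TProd TNat (TList TNat)) a) (TProd TNat (TList TNat)) :=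
  <(NAdd (Fst <<< Fst) (NatC 1), Cons <<< Fst)>.

Definition Count a : prog (TList a) (TProd TNat (TList TNat)) :=
  locked (Fold (@CountStep a) <<< <(@Const _ (TProd TNat (TList TNat)) (0, [::]), Id)>).

Lemma foldl_CountStep a (l : den (TList a)) n :
  foldl (fun (st : den (TProd TNat (TList TNat))) (y : den a) => run (@CountStep a) (st, y))
    (n, rev (iota 0 n)) l = (n + size l, rev (iota 0 (n + size l))).
Proof.
elim: l n => [|y l IH] n /=; first by rewrite addn0.
rewrite addnS -addSn -IH; congr foldl.
by rewrite /CountStep !runE -[in RHS]addn1 iotaD rev_cat.
Qed.

Lemma run_Count a (l : den (TList a)) :
  run (@Count a) l = (size l, rev (iota 0 (size l))).
Proof. by rewrite /Count -lock; apply: (foldl_CountStep l 0). Qed.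

Lemma bitsize_iota n : @bitsize (TList TNat) (iota 0 n) <= n * n.+2 + 1.
Proof.
have H m k : m + k <= n -> @bitsize (TList TNat) (iota m k) <= k * n.+2 + 1.
  elim: k m => [|k IH] m //= mk; have := nbits_leS m; have := IH m.+1.
  by rewrite bitsize_cons bitsize_nat mulSn; lia.
exact: (H 0).
Qed.

Lemma pt_Count a : ptime (@Count a).
Proof.
rewrite /Count -lock.
apply: (@pt_Fold _ _ _ _ _ (fun x => bitsize x + (bitsize x * (bitsize x + 2) + 1) + 2)).
- by rewrite /CountStep; ptime.
- by ptime.
- by pb.
move=> l l1 l2; rewrite !runE => E; have {}E : l = l1 ++ l2 by [].
rewrite (foldl_CountStep l1 0) bitsize_pair bitsize_rev bitsize_nat add0n.
have := bitsize_iota (size l1); have := nbits_leS (size l1).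
have := size_bitsize l1; have := bitsize_catl l1 l2; rewrite -E => H1 H2 H3 H4.
have : size l1 * (size l1).+2 <= bitsize l * (bitsize l + 2) by apply: leq_mul; lia.
lia.
Qed.
#[local] Hint Resolve pt_Count : ptime.

Definition Size a : prog (TList a) TNat := locked (Fst <<< @Count a).
Lemma run_Size a (l : den (TList a)) : run (@Size a) l = size l.
Proof. by rewrite /Size -lock runE run_Count. Qed.
Lemma pt_Size a : ptime (@Size a). Proof. by rewrite /Size -lock; ptime. Qed.

Definition Indices a : prog (TList a) (TList TNat) :=
  locked (@Rev TNat <<< Snd <<< @Count a).
Lemma run_Indices a (l : den (TList a)) : run (@Indices a) l = iota 0 (size l).
Proof. by rewrite /Indices -lock !runE run_Count /= run_Rev revK. Qed.
Lemma pt_Indices a : ptime (@Indices a). Proof. by rewrite /Indices -lock; ptime. Qed.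
#[local] Hint Resolve pt_Size pt_Indices : ptime.

Section Nth.
Variables (a : ty) (d : den a).

(** There is no early exit, so the state carries the index sought, the current position and the
    answer so far. The answer starts as [d], which is then returned for an index out of range. *)
Definition NthStep : prog (TProd (TProd (TProd TNat TNat) a) a) (TProd (TProd TNat TNat) a) :=
  <(<(Fst <<< Fst <<< Fst, NAdd (Snd <<< Fst <<< Fst) (NatC 1))>,
    If (Eqn (Snd <<< Fst <<< Fst) (Fst <<< Fst <<< Fst)) Snd (Snd <<< Fst))>.

Definition Nth : prog (TProd (TList a) TNat) a :=
  locked (Snd <<< Fold NthStep <<< <(<(<(Snd, NatC 0)>, Const d)>, Fst)>).

Definition nth_fold (n j : nat) (r : den a) (l : den (TList a)) :
    den (TProd (TProd TNat TNat) a) :=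
  foldl (fun (st : den (TProd (TProd TNat TNat) a)) (y : den a) => run NthStep (st, y))
    ((n, j), r) l.

Lemma nth_fold_cons n j r y l :
  nth_fold n j r (y :: l) = nth_fold n j.+1 (if j == n then y else r) l.
Proof.
rewrite {1}/nth_fold /=; congr foldl.
by rewrite /NthStep !runE run_If holds_Eqn !runE addn1.
Qed.

Lemma nth_foldE n j r l : nth_fold n j r l =
  ((n, j + size l), if j <= n < j + size l then nth d l (n - j) else r).
Proof.
elim: l j r => [|y l IH] j r; first by rewrite addn0 ltnNge andbN.
rewrite nth_fold_cons IH /= addnS addSn; case: (ltngtP j n) => jn.
- by case: ifP => // _; rewrite subnS; case: (n - j) (subn_gt0 j n) => //; rewrite jn.
- by [].
- by rewrite jn ltnS leq_addr subnn.
Qed.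

Lemma run_Nth (l : den (TList a)) (n : nat) : run Nth (l, n) = nth d l n.
Proof.
rewrite /Nth -lock !runE /= -[run (Fold _) _]/(nth_fold n 0 d l) nth_foldE /= subn0.
by case: ifP => // /negbT; rewrite -leqNgt => H; rewrite nth_default.
Qed.

Lemma bitsize_nth_fold n j r l :
  bitsize (nth_fold n j r l) <= nbits n + (j + size l).+1 + bitsize r + bitsize l + 2.
Proof.
rewrite nth_foldE !bitsize_pair !bitsize_nat; have := nbits_leS (j + size l).
case: ifP => [H|_]; last by lia.
have /(@bitsize_nth a l _ d) : n - j < size l by lia.
set w := bitsize (nth _ _ _); lia.
Qed.

Lemma pt_Nth : ptime Nth.
Proof.
rewrite /Nth -lock; apply: pt_Comp (pt_Snd _ _) _.
apply: (@pt_Fold _ _ _ _ _ (fun x => bitsize x + (bitsize x).+1 + bitsize d + bitsize x + 2)).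
- by rewrite /NthStep; ptime.
- by ptime.
- by pb; apply: (pb_le (h := fun x => bitsize x + 1)) => [x|]; [rewrite addn1|pb].
elim/den_pair_ind=> l n l1 l2; rewrite !runE => E; have {}E : l = l1 ++ l2 by [].
rewrite -[foldl _ _ _]/(nth_fold n 0 d l1); apply: leq_trans (bitsize_nth_fold _ _ _ _) _.
rewrite bitsize_pair bitsize_nat.
have := size_bitsize l1; have := bitsize_catl l1 l2; rewrite -E; lia.
Qed.

End Nth.
#[local] Hint Resolve pt_Nth : ptime.

Definition PlengthStep : prog (TProd TRat arc_ty) TRat :=
  RAdd Fst (Snd <<< Snd).
Definition Plength : prog pathway_ty TRat :=
  locked (Fold PlengthStep <<< <(RatC 0%R, Id)>).

Lemma foldl_PlengthStep (q : pathway) (r : rat) :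
  foldl (fun (st : den TRat) (y : den arc_ty) => run PlengthStep (st, y)) r q
  = (r + plength q)%R.
Proof.
elim: q r => [|e q IH] r /=; rewrite /plength ?big_nil ?addr0 // big_cons addrA.
exact: IH.
Qed.

Lemma run_Plength (q : pathway) : run Plength q = plength q.
Proof. by rewrite /Plength -lock -[RHS]add0r -foldl_PlengthStep. Qed.

(** Controls the partial sums in [Plength]: adding up many rationals multiplies denominators, but
    the bits spent on this are already present in the listed weights. *)
Lemma height_plength (q : pathway) : nbits (height (plength q)) <= @bitsize (TList arc_ty) q.
Proof.
elim: q => [|e q IH]; first by rewrite /plength big_nil /height /= /nbits trunc_log1.
rewrite /plength big_cons; apply: leq_trans (nbits_mono (heightD _ _)) _.
apply: leq_trans (nbits_mul _ _) _.
have := nbits_height (weight e); rewrite bitsize_cons.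
have -> : @bitsize arc_ty e = (@bitsize (TProd TNat TNat) e.1 + @bitsize TRat (weight e)).+1.
  by [].
rewrite -/(plength q); set u := @bitsize (TProd _ _) _; set v := @bitsize TRat _.
lia.
Qed.

Lemma pt_Plength : ptime Plength.
Proof.
rewrite /Plength -lock.
apply: (@pt_Fold _ _ _ _ _ (fun x => 2 * bitsize x + 1)).
- by rewrite /PlengthStep; ptime.
- by ptime.
- by pb.
move=> q l1 l2; rewrite !runE => E; have {}E : q = l1 ++ l2 by [].
rewrite foldl_PlengthStep add0r; apply: leq_trans (bitsize_rat_le _) _.
rewrite leq_add2r leq_mul2l /=; apply: leq_trans (height_plength l1) _.
by rewrite E; apply: (@bitsize_catl arc_ty).
Qed.
#[local] Hint Resolve pt_Plength : ptime.

(** * Shortest paths by the Bellman-Ford algorithm *)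

(* A vertex [u] with a simple path from [u] to the destination. *)
Definition label : Type := (nat * pathway)%type.

Definition extendable (c : label * arc) : bool :=
  (head c.2 == c.1.1) && (tail c.2 \notin c.1.1 :: [seq head e | e <- c.1.2]).

Definition extend (c : label * arc) : label := (tail c.2, c.2 :: c.1.2).

Definition candidates (G : graph) (L : seq label) : seq label :=
  L ++ [seq extend c | c <- [seq c <- [seq (b, e) | b <- L, e <- arcs G] | extendable c]].

Definition beats (v : nat) (c c' : label) : bool :=
  (c'.1 == v) && ~~ (plength c.2 <= plength c'.2)%R.

(** A minimum found by comparing all pairs, with ties cut by [take 1]. The result is a list of
    length at most one: empty when [v] has no label yet, and never longer, so the label list does
    not grow from round to round. *)
Definition best (C : seq label) (v : nat) : seq label :=
  take 1 [seq c <- C | (c.1 == v) && ~~ has (beats v c) C].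

Definition bf_round (G : graph) (L : seq label) : seq label :=
  flatten [seq best (candidates G L) v | v <- vertices G].

Definition bf (G : graph) (k : nat) : seq label :=
  iter k (bf_round G) [:: (destination G, [::])].

Definition label_ok (G : graph) (c : label) : bool :=
  walk G c.1 c.2 (destination G) && uniq (c.1 :: [seq head e | e <- c.2]).

Lemma best_sub C v : {subset best C v <= C}.
Proof. by move=> c /mem_take; rewrite mem_filter => /andP[]. Qed.

Lemma bestP C v c : c \in best C v ->
  c.1 = v /\ forall c', c' \in C -> c'.1 = v -> (plength c.2 <= plength c'.2)%R.
Proof.
move/mem_take; rewrite mem_filter => /andP[/andP[/eqP cv /hasPn H] _].
by split=> // c' c'C c'v; have := H c' c'C; rewrite /beats c'v eqxx negbK.
Qed.

Lemma exists_min (I : eqType) (w : I -> rat) (s : seq I) : s != [::] ->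
  exists2 c, c \in s & forall c', c' \in s -> (w c <= w c')%R.
Proof.
elim: s => // x s IH _; case: (eqVneq s [::]) => [->|/IH[c cs Hc]].
  by exists x; rewrite ?mem_head // => c'; rewrite mem_seq1 => /eqP->.
case: (lerP (w x) (w c)) => xc.
  exists x; first exact: mem_head.
  by move=> c'; rewrite inE => /orP[/eqP->//|/Hc]; apply: le_trans.
exists c; first by rewrite inE cs orbT.
by move=> c'; rewrite inE => /orP[/eqP->|/Hc//]; apply: ltW.
Qed.

Lemma best_exists C v c : c \in C -> c.1 = v -> exists b, b \in best C v.
Proof.
move=> cC cv; set P := fun c' : label => c'.1 == v.
have [|b] := @exists_min _ (fun c' : label => plength c'.2) [seq c' <- C | P c'].
  by rewrite -has_filter; apply/hasP; exists c => //; apply/eqP.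
rewrite mem_filter => /andP[bv bC] Hb.
have {bC}: b \in [seq c <- C | (c.1 == v) && ~~ has (beats v c) C].
  rewrite mem_filter bC andbT; apply/andP; split=> //; apply/hasPn => c' c'C.
  apply/negP => /andP[c'v /negP]; apply; apply: Hb.
  by rewrite mem_filter /P c'v.
rewrite /best; case: (filter _ _) => // b' s _; exists b'.
by rewrite /= take0 mem_head.
Qed.

Lemma size_best C v : size (best C v) <= 1.
Proof. by rewrite size_take_min geq_minl. Qed.

Lemma extend_ok G c : c.2 \in arcs G -> label_ok G c.1 -> extendable c ->
  label_ok G (extend c).
Proof.
case: c => [[u q] e] /= eG /andP[/= w /andP[uq Uq]] /andP[/= /eqP eu te].
by rewrite /label_ok /= eG eqxx eu w uq Uq !andbT te.
Qed.

Lemma candidatesP G L c : c \in candidates G L ->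
  c \in L \/ exists b e, [/\ b \in L, e \in arcs G, extendable (b, e) & c = extend (b, e)].
Proof.
rewrite mem_cat => /orP[|/mapP[[b e]]]; first by left.
rewrite mem_filter => /andP[ext /allpairsP[[b' e'] /= [bL eG E]]] ->.
by right; exists b', e'; rewrite -E.
Qed.

Lemma mem_bf_round G L c : c \in bf_round G L ->
  exists2 v, v \in vertices G & c \in best (candidates G L) v.
Proof. by case/flattenP => s /mapP[v vG ->] ?; exists v. Qed.

(** Serves twice: it makes the returned label a genuine path, and, being true of malformed graphs as
    well, it bounds the state of the program in [pt_Bf]. *)
Lemma bf_ok G k c : c \in bf G k -> label_ok G c && (size c.2 <= k).
Proof.
elim: k c => [|k IH] c.
  by rewrite mem_seq1 => /eqP->; rewrite /label_ok /= eqxx.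
case/mem_bf_round => v _ /best_sub /candidatesP[/IH/andP[-> /leqW]//|].
move=> [b [e [/IH/andP[ok sz] eG ext ->]]].
by rewrite extend_ok.
Qed.

(** The [+ 1] is for the initial list, which has its label even if [vertices G] is empty. *)
Lemma size_bf G k : size (bf G k) <= size (vertices G) + 1.
Proof.
case: k => [|k]; first by rewrite addn1.
apply: (@leq_trans (size (vertices G))); last by rewrite leq_addr.
rewrite /bf iterS; move: (iter _ _ _) => L; rewrite /bf_round.
elim: (vertices G) => //= v s IH.
by rewrite size_cat -(add1n (size s)) leq_add // size_best.
Qed.

Lemma walk_cat G u q1 q2 v : walk G u (q1 ++ q2) v =
  walk G u q1 (last u [seq head e | e <- q1]) && walk G (last u [seq head e | e <- q1]) q2 v.
Proof. by elim: q1 u => [|e q1 IH] u /=; rewrite ?eqxx // IH !andbA. Qed.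

Lemma walk_tail G u q v : is_graph G -> v \in vertices G -> walk G u q v ->
  u \in vertices G.
Proof.
move=> [_ aG _ _]; case: q => [|e q] vG /=; first by move/eqP->.
by case/and3P => /aG/andP[tG _] /eqP <-.
Qed.

Lemma plength_cons e q : plength (e :: q) = (weight e + plength q)%R.
Proof. by rewrite /plength big_cons. Qed.

Lemma plength_cat q1 q2 : plength (q1 ++ q2) = (plength q1 + plength q2)%R.
Proof. by rewrite /plength big_cat. Qed.

(* When the tail of [e] is already on the simple path [q], the arc closes a simple
   cycle, whose removal does not increase the length. *)
Lemma close_cycle G u q e v : no_negative_cycle G -> e \in arcs G ->
  head e = u -> walk G u q v -> uniq (u :: [seq head e | e <- q]) ->
  tail e \in u :: [seq head e | e <- q] ->
  exists q2, [/\ walk G (tail e) q2 v, size q2 <= size q &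
                 (plength q2 <= weight e + plength q)%R].
Proof.
move=> nn eG eu w; move E : [seq head e | e <- q] => p U te.
case/splitPl: te E U => p1 p2 last1 E U.
have [q1 [q2 [Eq E1]]] : exists q1 q2, q = q1 ++ q2 /\ [seq head e | e <- q1] = p1.
  exists (take (size p1) q), (drop (size p1) q); rewrite cat_take_drop; split=> //.
  by rewrite map_take E take_size_cat.
move: w U; rewrite Eq walk_cat E1 last1 -cat_cons cat_uniq => /andP[w1 w2] /andP[U1 _].
exists q2; split=> //; first by rewrite size_cat leq_addl.
have : (0 <= plength (e :: q1))%R.
  by apply: nn; exists (tail e); split; rewrite //= ?eG ?eqxx ?eu ?E1.
by rewrite plength_cons plength_cat; lra.
Qed.

(** The first arc of the walk is put in front of the label found for the remainder. If the result is
    simple, it is a candidate of the next round; if not, cutting out the cycle leaves a walk of at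
    most [k] arcs, which the previous round already handles. *)
Lemma bf_le G k q u : is_graph G -> no_negative_cycle G ->
  walk G u q (destination G) -> size q <= k ->
  exists2 c, c \in bf G k & c.1 = u /\ (plength c.2 <= plength q)%R.
Proof.
move=> gG nn; have dG : destination G \in vertices G by case: gG.
elim: k u q => [|k IH] u q w.
  rewrite leqn0 size_eq0 => /eqP q0; move: w; rewrite q0 => /eqP ->.
  by exists (destination G, [::]); rewrite ?mem_seq1.
have uG := walk_tail gG dG w.
move=> sz; suff [c cC [cu cq]] : exists2 c, c \in candidates G (bf G k) &
    c.1 = u /\ (plength c.2 <= plength q)%R.
  have [b bB] := best_exists cC cu; have [bu Hb] := bestP bB.
  exists b; last by split=> //; apply: le_trans cq; apply: Hb.
  by apply/flattenP; exists (best (candidates G (bf G k)) u) => //; apply: map_f.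
(* Labels of the previous round stay candidates, so it is enough to find a walk of at most [k] arcs
   that is no longer than [q]. *)
have old q' : walk G u q' (destination G) -> size q' <= k ->
    (plength q' <= plength q)%R ->
    exists2 c, c \in candidates G (bf G k) & c.1 = u /\ (plength c.2 <= plength q)%R.
  move=> w' sz' le'; have [c cL [cu cq]] := IH _ _ w' sz'.
  by exists c; [rewrite mem_cat cL | split=> //; apply: le_trans le'].
case: q sz w old => [|e q] sz w old; first exact: (old [::]).
move: w => /= /and3P[eG /eqP te w].
have [c cL [cu cq]] := IH _ _ w sz.
have /andP[/andP[cw cU] csz] := bf_ok cL.
have [te_in|te_out] := boolP (tail e \in c.1 :: [seq head e | e <- c.2]).
  have [q2 [w2 sz2 le2]] := close_cycle nn eG (esym cu) cw cU te_in.
  apply: (old q2); rewrite -?te //; first exact: leq_trans sz2 csz.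
  by rewrite plength_cons; lra.
exists (extend (c, e)); last by rewrite /= te !plength_cons; split=> //; lra.
rewrite mem_cat; apply/orP; right; apply: map_f; rewrite mem_filter /extendable /= cu eqxx.
by rewrite -{1}cu te_out; apply/allpairsP; exists (c, e).
Qed.

Lemma walk_heads G u q v : is_graph G -> walk G u q v -> v \in vertices G ->
  {subset u :: [seq head e | e <- q] <= vertices G}.
Proof.
move=> gG + vG; elim: q u => [|e q IH] u /=; first by move/eqP-> => w; rewrite mem_seq1 => /eqP->.
move=> /[dup] w /and3P[_ _ /IH H] z; rewrite in_cons => /orP[/eqP->|]; last exact: H.
exact: (@walk_tail G u (e :: q) v).
Qed.

Definition shortest (G : graph) : unit + pathway :=
  if [seq c <- bf G (size (vertices G)) | c.1 == source G] is c :: _ then inr c.2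
  else inl tt.

Lemma shortest_correct : solves_shortest_path shortest.
Proof.
move=> G gG nn; have dG : destination G \in vertices G by case: gG.
have H q : is_sd_path G q ->
    exists2 c, c \in bf G (size (vertices G)) &
      c.1 = source G /\ (plength c.2 <= plength q)%R.
  (* A simple path visits distinct vertices, so it has fewer arcs than there are vertices. *)
  move=> [w U]; apply: bf_le => //; apply: ltnW.
  by have := uniq_leq_size U (walk_heads gG w dG); rewrite /= size_map.
rewrite /shortest; set s := filter _ _.
have inS c : c \in s -> c.1 = source G /\ c \in bf G (size (vertices G)).
  by rewrite mem_filter => /andP[/eqP].
case Es : s => [|c s'].
  move=> q /H[c cL [cs _]].
  have : c \in s by rewrite mem_filter cs eqxx.
  by rewrite Es.
have [cs cL] : c.1 = source G /\ c \in bf G (size (vertices G)).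
  by apply: inS; rewrite Es mem_head.
have /andP[/andP[w U] _] := bf_ok cL; rewrite cs in w U.
split=> // q /H[c' c'L [c's]]; apply: le_trans.
(* At least one round has been run, so the label [c] was chosen by [best] and beats every candidate
   at the source, [c'] included. *)
have [k Ek] : exists k, size (vertices G) = k.+1.
  by case: (vertices G) dG => // a l _; exists (size l).
move: cL c'L; rewrite Ek => /mem_bf_round[v _ /bestP[cv Hc]].
by case/mem_bf_round => v' _ /best_sub c'C; apply: Hc; rewrite // c's -cv.
Qed.

(** * Bellman-Ford as a program of polynomial cost *)

Definition label_ty := TProd TNat pathway_ty.

Definition Heads : prog pathway_ty (TList TNat) :=
  locked (Map (Snd <<< Fst <<< Snd) <<< <(@Const _ TUnit tt, Id)>).
Lemma run_Heads (q : pathway) : run Heads q = [seq head e | e <- q].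
Proof. by rewrite /Heads -lock !runE /= run_Map. Qed.
Lemma pt_Heads : ptime Heads. Proof. by rewrite /Heads -lock; ptime. Qed.
#[local] Hint Resolve pt_Heads : ptime.

Definition Extendable : prog (TProd TUnit (TProd label_ty arc_ty)) TBool :=
  locked (And (Eqn (Snd <<< Fst <<< Snd <<< Snd) (Fst <<< Fst <<< Snd))
    (Not (Mem <<< <(Fst <<< Fst <<< Snd <<< Snd,
                    Cons <<< <(Fst <<< Fst <<< Snd, Heads <<< Snd <<< Fst <<< Snd)>)>))).
Lemma holds_Extendable (c : label * arc) : holds (run Extendable (tt, c)) = extendable c.
Proof.
case: c => [[u q] e].
by rewrite /Extendable -lock holds_And holds_Not holds_Eqn !runE /= run_Heads holds_Mem.
Qed.
Lemma pt_Extendable : ptime Extendable. Proof. by rewrite /Extendable -lock; ptime. Qed.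
#[local] Hint Resolve pt_Extendable : ptime.

Definition Extend : prog (TProd TUnit (TProd label_ty arc_ty)) label_ty :=
  <(Fst <<< Fst <<< Snd <<< Snd, Cons <<< <(Snd <<< Snd, Snd <<< Fst <<< Snd)>)>.

Definition Candidates : prog (TProd graph_ty (TList label_ty)) (TList label_ty) :=
  locked (@Cat label_ty <<< <(Snd, Map Extend <<< <(@Const _ TUnit tt,
    Filter Extendable <<< <(@Const _ TUnit tt,
      @Pairs label_ty arc_ty <<< <(Snd, Snd <<< Fst <<< Fst)>)>)>)>).
Lemma run_Candidates (G : graph) (L : seq label) : run Candidates (G, L) = candidates G L.
Proof.
rewrite /Candidates -lock !runE /= run_Pairs run_Filter run_Map run_Cat.
by rewrite (eq_filter holds_Extendable).
Qed.
Lemma pt_Candidates : ptime Candidates.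
Proof. by rewrite /Candidates /Extend -lock; ptime. Qed.
#[local] Hint Resolve pt_Candidates : ptime.

Definition Beats : prog (TProd (TProd TNat label_ty) label_ty) TBool :=
  And (Eqn (Fst <<< Snd) (Fst <<< Fst))
      (Not (Prim RatLe <<< <(Plength <<< Snd <<< Snd <<< Fst, Plength <<< Snd <<< Snd)>)).
Lemma holds_Beats v (c c' : label) : holds (run Beats ((v, c), c')) = beats v c c'.
Proof.
case: c c' => [u q] [u' q']; rewrite /Beats holds_And holds_Not holds_Eqn !runE /= !run_Plength.
by rewrite of_boolK.
Qed.
Lemma pt_Beats : ptime Beats. Proof. by rewrite /Beats; ptime. Qed.
#[local] Hint Resolve pt_Beats : ptime.

Definition Best : prog (TProd (TList label_ty) TNat) (TList label_ty) :=
  locked (@Take1 label_ty <<<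
    Filter (And (Eqn (Fst <<< Snd) (Snd <<< Fst))
                (Not (Has Beats <<< <(<(Snd <<< Fst, Snd)>, Fst <<< Fst)>)))
    <<< <(Id, Fst)>).
Lemma run_Best (C : seq label) (v : nat) : run Best (C, v) = best C v.
Proof.
rewrite /Best -lock !runE /= run_Filter run_Take1 /best; congr take; apply: eq_filter => c.
rewrite holds_And holds_Not holds_Eqn !runE /= holds_Has; congr (_ && ~~ _).
by apply: eq_has => c'; apply: holds_Beats.
Qed.
Lemma pt_Best : ptime Best. Proof. by rewrite /Best -lock; ptime. Qed.
#[local] Hint Resolve pt_Best : ptime.

Definition BfRound : prog (TProd graph_ty (TList label_ty)) (TList label_ty) :=
  locked (@Flatten label_ty <<< Map Best <<< <(Candidates, Fst <<< Fst <<< Fst)>).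
Lemma run_BfRound (G : graph) (L : seq label) : run BfRound (G, L) = bf_round G L.
Proof.
rewrite /BfRound -lock !runE /= run_Candidates run_Map run_Flatten /bf_round.
by congr flatten; apply: eq_map => v; rewrite run_Best.
Qed.
Lemma pt_BfRound : ptime BfRound. Proof. by rewrite /BfRound -lock; ptime. Qed.
#[local] Hint Resolve pt_BfRound : ptime.

(** The vertex list is traversed only as a clock: one round per entry, whatever the entry is. *)
Definition BfStep : prog (TProd (TProd graph_ty (TList label_ty)) TNat)
                         (TProd graph_ty (TList label_ty)) :=
  <(Fst, BfRound)> <<< Fst.

Definition Bf : prog graph_ty (TList label_ty) :=
  locked (Snd <<< Fold BfStep <<<
    <(<(Id, Cons <<< <(<(Snd <<< Snd, Nil arc_ty)>, Nil label_ty)>)>, Fst <<< Fst)>).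

Lemma foldl_BfStep (G : graph) (L : seq label) (s : seq nat) :
  foldl (fun (st : den (TProd graph_ty (TList label_ty))) (y : den TNat) =>
    run BfStep (st, y)) (G, L) s = (G, iter (size s) (bf_round G) L).
Proof.
elim: s L => [|v s IH] L //; rewrite [size _]/= iterSr -IH /=; congr foldl.
by rewrite /BfStep !runE /= run_BfRound.
Qed.

Lemma run_Bf (G : graph) : run Bf G = bf G (size (vertices G)).
Proof.
rewrite /Bf -lock !runE /= -[run (Fold _) _]/(foldl
  (fun (st : den (TProd graph_ty (TList label_ty))) (y : den TNat) => run BfStep (st, y))
  (G, [:: (destination G, [::])]) (vertices G)).
by rewrite foldl_BfStep.
Qed.

Lemma bitsize_seq_le a (I : eqType) (f : I -> den a) (s : seq I) M :
  {in s, forall x, bitsize (f x) <= M} ->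
  @bitsize (TList a) [seq f x | x <- s] <= size s * M.+1 + 1.
Proof.
elim: s => [|x s IH] H //=; rewrite bitsize_cons mulSn.
have Hx := H x (mem_head x s); have {}IH := IH _.
have {}IH := IH (fun y ys => H y (etrans (in_cons _ _ _) (introT orP (or_intror ys)))).
lia.
Qed.

Lemma bitsize_mem a (I : eqType) (f : I -> den a) (s : seq I) x :
  x \in s -> bitsize (f x) <= @bitsize (TList a) [seq f y | y <- s].
Proof.
elim: s => // y s IH; rewrite in_cons bitsize_cons => /orP[/eqP->|/IH H].
  by rewrite ltnW // ltnS leq_addr.
by apply: leq_trans H _; rewrite ltnW // ltnS leq_addl.
Qed.

(** Distinct heads force distinct arcs, so a label has at most as many arcs as [G]. Counting arcs
    rather than vertices keeps this valid when the endpoints of arcs are missing from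
    [vertices G]. *)
Lemma bitsize_label G c : label_ok G c ->
  @bitsize label_ty c <= @bitsize graph_ty G * (@bitsize graph_ty G + 4).
Proof.
case: c => u q /andP[/= w /andP[_ /map_uniq U]].
set N := @bitsize graph_ty G.
have sub : {subset q <= arcs G}.
  elim: q u w {U} => // e q IH u /= /and3P[eG _ /IH H] e'.
  by rewrite inE => /orP[/eqP->|/H].
have NE : N = ((@bitsize (TList TNat) (vertices G) + @bitsize (TList arc_ty) (arcs G)).+1
               + (nbits (source G) + nbits (destination G)).+1).+1.
  by rewrite /N; case: G {w sub N} => [[? ?] [? ?]]; rewrite !bitsize_pair.
have arcN e : e \in arcs G -> @bitsize arc_ty e <= @bitsize (TList arc_ty) (arcs G).
  by move/(@bitsize_mem arc_ty _ id); rewrite map_id.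
(* [u] occurs in the graph: as the destination if the path is empty, otherwise as the tail of its
   first arc. *)
have uN : nbits u <= N.
  case: q w sub {U} => [/eqP->|e q] /=; first by lia.
  case/and3P => /arcN + /eqP <- _ _; case: e => [[t h] z].
  by rewrite !bitsize_pair !bitsize_nat /tail /=; lia.
have qN : @bitsize (TList arc_ty) q <= size q * N.+1 + 1.
  have := @bitsize_seq_le arc_ty _ id q N; rewrite map_id; apply => e /sub /arcN.
  by move/leq_trans; apply; rewrite NE; lia.
have sz : size q <= N.
  apply: leq_trans (uniq_leq_size U sub) _.
  by apply: leq_trans (ltnW (@size_bitsize arc_ty (arcs G))) _; rewrite NE; lia.
rewrite bitsize_pair bitsize_nat.
change (@bitsize pathway_ty q) with (@bitsize (TList arc_ty) q).
have : size q * N.+1 <= N * N.+1 by rewrite leq_mul2r sz orbT.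
have : 0 < N by rewrite NE.
rewrite mulnDr mulnS; lia.
Qed.

Lemma pt_Bf : ptime Bf.
Proof.
rewrite /Bf -lock; apply: pt_Comp (pt_Snd _ _) _.
apply: (@pt_Fold _ _ _ _ _ (fun x => bitsize x +
  ((bitsize x + 1) * (bitsize x * (bitsize x + 4) + 1) + 1) + 1)).
- by rewrite /BfStep; ptime.
- by rewrite /Nil; ptime.
- by pb.
move=> G l1 l2; rewrite !runE /= => E; have {}E : vertices G = l1 ++ l2 by [].
have {}E := congr1 size E; rewrite size_cat in E.
rewrite -[foldl _ _ _]/(foldl
  (fun (st : den (TProd graph_ty (TList label_ty))) (y : den TNat) => run BfStep (st, y))
  (G, [:: (destination G, [::])]) l1).
rewrite foldl_BfStep -/(bf G (size l1)) bitsize_pair.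
have szV : size (vertices G) <= @bitsize graph_ty G.
  apply: leq_trans (ltnW (@size_bitsize TNat (vertices G))) _.
  by case: G {E} => [[vs es] st]; rewrite !bitsize_pair /vertices /=; lia.
set N := @bitsize graph_ty G in szV *.
have : @bitsize (TList label_ty) (bf G (size l1)) <=
    size (bf G (size l1)) * (N * (N + 4)).+1 + 1.
  have := @bitsize_seq_le label_ty _ id (bf G (size l1)); rewrite map_id; apply.
  by move=> c /bf_ok/andP[/bitsize_label].
have : size (bf G (size l1)) * (N * (N + 4)).+1 <= (N + 1) * (N * (N + 4) + 1).
  rewrite -[(N * _).+1]addn1 leq_mul2r; apply/orP; right.
  by apply: leq_trans (size_bf _ _) _; rewrite leq_add2r.
set A := @bitsize (TList label_ty) _; set B := _ * _.+1; set C := (N + 1) * _; lia.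
Qed.
#[local] Hint Resolve pt_Bf : ptime.

Definition Shortest : prog graph_ty (TSum TUnit pathway_ty) :=
  locked (Match (@Uncons label_ty <<<
      Filter (Eqn (Fst <<< Snd) Fst) <<< <(Fst <<< Snd, Bf)>)
    (Inl <<< Snd) (Inr <<< Snd <<< Fst <<< Snd)).
Lemma run_Shortest (G : graph) : run Shortest G = shortest G.
Proof.
rewrite /Shortest -lock /Match !runE /= run_Bf run_Filter.
rewrite (@eq_filter _ _ (fun c : label => c.1 == source G)) => [|c]; last first.
  by rewrite holds_Eqn !runE /=.
by rewrite /shortest; case: (filter _ _).
Qed.
Lemma pt_Shortest : ptime Shortest.
Proof. by rewrite /Shortest -lock /Match; ptime. Qed.
#[local] Hint Resolve pt_Shortest : ptime.

(** * The layered graph of cache states *)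

(* Layer [t] holds the cache states after slot [t]: state [0] means that the content is
   not cached, state [i.+1] that it is cached with AoI [i].  Layer [0] is the source
   layer, and the single arcs into layer [T + 1] carry the constant [- beta]. *)
Section LayeredGraph.
Local Open Scope ring_scope.
Variable z : den sp_ty.

Definition sp_size : rat := z.1.1.1.1.1.1.
Definition sp_requests : seq nat := z.1.1.1.1.1.2.
Definition sp_cs : rat := z.1.1.1.1.2.1.
Definition sp_cb : rat := z.1.1.1.1.2.2.
Definition sp_ages : seq rat := z.1.1.1.2.
Definition sp_lambda : rat := z.1.1.2.
Definition sp_pi : seq rat := z.1.2.
Definition sp_beta : rat := z.2.

Definition slots : nat := size sp_requests.

(** Positional notation in base [slots.+1], the number of states of a layer; later layers receive
    larger codes. *)
Definition code (t s : nat) : nat := (t * slots.+1 + s)%N.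

(* Cost of state [s] in slot [t.+1]. *)
Definition slot_cost (t s : nat) : rat :=
  let m := (nth 0%N sp_requests t)%:R in
  if s == 0%N then sp_size * m * sp_cs
  else sp_size * m * sp_cb - sp_size * nth 0 sp_pi t +
       (if s == 1%N then sp_size * (sp_cs - sp_cb)
        else sp_lambda * (nth 0 sp_ages (s - 2) * m)).

Definition step_weight (t s : nat) : rat :=
  if (t < slots)%N then slot_cost t s else - sp_beta.

(** [c] is a layer with the states before and after the step. Dropping the content ([0]) and
    downloading it afresh ([1]) are always possible; otherwise a cached content ages by one. The
    second factor sends all states of the last slot to the destination. *)
Definition step_ok (c : nat * (nat * nat)) : bool :=
  (((c.2.2 <= 1) || (0 < c.2.1) && (c.2.2 == c.2.1.+1)) && ((c.1 < slots) || (c.2.2 == 0)))%N.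

Definition step_arc (c : nat * (nat * nat)) : arc :=
  (code c.1 c.2.1, code c.1.+1 c.2.2, step_weight c.1 c.2.2).

Definition states : seq nat := iota 0 slots.+1.

Definition layered_graph : graph :=
  (([seq code c.1 c.2 | c <- [seq (t, s) | t <- iota 0 slots.+2, s <- states]],
    [seq step_arc c | c <- [seq c <- [seq (t, c) | t <- states,
       c <- [seq (s, s') | s <- states, s' <- states]] | step_ok c]]),
   (0%N, code slots.+1 0)).

(** The solution depends only on which vertices are visited. Each row is cut out of [iota 0 slots]
    by a filter because [Indices] enumerates positions of an existing list. *)
Definition read_path (q : pathway) : solution :=
  let hs := [seq head e | e <- q] in
  ([seq (if code t.+1 0 \in hs then 0 else 1) | t <- iota 0 slots],
   [seq [seq (if code t.+1 i.+1 \in hs then 1 else 0)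
        | i <- [seq i <- iota 0 slots | (i <= t)%N]] | t <- iota 0 slots]).

Lemma code_lt t s t' s' : (t < t')%N -> (s <= slots)%N -> (code t s < code t' s')%N.
Proof. by rewrite /code => *; nia. Qed.

Lemma code_inj t s t' s' : (s <= slots)%N -> (s' <= slots)%N ->
  code t s = code t' s' -> t = t' /\ s = s'.
Proof.
move=> sT s'T E; case: (ltngtP t t') => [/code_lt|/code_lt|tt'].
- by move/(_ s s' sT); rewrite E ltnn.
- by move/(_ s' s s'T); rewrite E ltnn.
by split=> //; move: E; rewrite /code tt'; apply: addnI.
Qed.

Lemma mem_states s : (s \in states) = (s <= slots)%N.
Proof. by rewrite mem_iota add0n ltnS. Qed.

Lemma mem_arcs e : e \in arcs layered_graph ->
  exists t s s', [/\ (t <= slots)%N, (s <= slots)%N, (s' <= slots)%N,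
                     step_ok (t, (s, s')) & e = step_arc (t, (s, s'))].
Proof.
case/mapP => c; rewrite mem_filter => /andP[ok /allpairsP[[t c'] [tS c'S Ec]]] ->.
move: c'S => /allpairsP[[s s'] [sS s'S Ec']].
have {Ec Ec'}Ec : c = (t, (s, s')) by rewrite Ec [c']Ec'.
by rewrite Ec in ok *; exists t, s, s'; rewrite -!mem_states.
Qed.

Lemma arc_mem t s s' : (t <= slots)%N -> (s <= slots)%N -> (s' <= slots)%N ->
  step_ok (t, (s, s')) -> step_arc (t, (s, s')) \in arcs layered_graph.
Proof.
rewrite -!mem_states => tS sS s'S ok; apply: map_f; rewrite mem_filter ok.
by apply/allpairsP; exists (t, (s, s')); split=> //; apply/allpairsP; exists (s, s').
Qed.

Lemma vertex_mem t s : (t <= slots.+1)%N -> (s <= slots)%N ->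
  code t s \in vertices layered_graph.
Proof.
move=> tS sS; apply/mapP; exists (t, s) => //; apply/allpairsP; exists (t, s).
by rewrite mem_states mem_iota ltnS.
Qed.

Lemma layered_graphP : is_graph layered_graph.
Proof.
split; last exact: vertex_mem.
- rewrite map_inj_in_uniq; first by apply: allpairs_uniq => [||[? ?] [? ?] _ _]; rewrite ?iota_uniq.
  move=> c c' /allpairsP[[t s] [_ sS ->]] /allpairsP[[t' s'] [_ s'S ->]] /=.
  by case/code_inj => [||-> ->]; rewrite -?mem_states.
- move=> e /mem_arcs[t [s [s' [tT sT s'T _ ->]]]].
  by rewrite !vertex_mem // ltnW.
- exact: (@vertex_mem 0 0).
Qed.

(** Each arc enters the next layer, whose codes are larger. So there is no cycle at all, and
    negative weights do no harm. *)
Lemma walk_ltn u q v : walk layered_graph u q v -> q != [::] -> (u < v)%N.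
Proof.
elim: q u => // e q IH u /= /and3P[/mem_arcs[t [s [s' [_ sT _ _ ->]]]] /eqP <- w] _.
have lt1 : (code t s < code t.+1 s')%N by apply: code_lt.
case: q IH w => [_ /eqP <- //|e' q] IH w; exact: ltn_trans lt1 (IH _ w isT).
Qed.

Lemma layered_graph_acyclic : no_negative_cycle layered_graph.
Proof. by move=> q [u [q0 /walk_ltn/(_ q0)]]; rewrite ltnn. Qed.

(** A walk is determined by its state in each layer, so walks are handled as functions [st] from
    layers to states. *)
Definition state_path (st : nat -> nat) (t n : nat) : pathway :=
  [seq step_arc (j, (st j, st j.+1)) | j <- iota t n].

Definition state_walk (st : nat -> nat) (t t' : nat) : Prop :=
  forall j, (t <= j < t')%N -> step_ok (j, (st j, st j.+1)).

(** A step raises the state by at most one, starting from [0]. This recovers the range [i <= t - 1]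
    of the AoIs in slot [t], although every layer of the graph has the same number of states. *)
Lemma state_bound st t : st 0%N = 0%N -> state_walk st 0 slots.+1 ->
  (t <= slots.+1)%N -> (st t <= t)%N && (st t <= slots)%N.
Proof.
move=> st0 ok; elim: t => [|t IH] tT; first by rewrite st0.
have /andP[IH1 IH2] := IH (ltnW tT).
have := ok t tT; rewrite /step_ok /=; lia.
Qed.

Lemma walk_state_path st t n : (forall j, (j <= slots.+1)%N -> (st j <= slots)%N) ->
  state_walk st t (t + n) -> (t + n <= slots.+1)%N ->
  walk layered_graph (code t (st t)) (state_path st t n) (code (t + n) (st (t + n)%N)).
Proof.
move=> stT; elim: n t => [|n IH] t ok tn /=; first by rewrite addn0.
rewrite addnS -addSn in ok tn *.
have tT : (t <= slots)%N by lia.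
apply/and3P; split.
- by apply: arc_mem => //; [apply: stT; lia|apply: stT|apply: ok; lia].
- by [].
- by apply: IH => // j /andP[tj jn]; apply: ok; rewrite ltnW.
Qed.

Lemma walk_state_pathP t s q t' s' : walk layered_graph (code t s) q (code t' s') ->
  (s <= slots)%N -> (s' <= slots)%N ->
  (t <= t')%N /\ exists st, [/\ st t = s, st t' = s', state_walk st t t' &
                                q = state_path st t (t' - t)].
Proof.
move=> + + s'T; elim: q t s => [|e q IH] t s /=.
  move=> /eqP E sT; have [tt' ss'] := code_inj sT s'T E.
  rewrite tt'; split=> //; exists (fun=> s); split=> //; last by rewrite subnn.
  by move=> j; lia.
case/and3P => /mem_arcs[t1 [s1 [s2 [t1T s1T s2T ok ->]]]] /eqP E w sT.
have [t1t s1s] : t1 = t /\ s1 = s := code_inj s1T sT E; rewrite {}t1t {}s1s in w ok t1T *.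
have [tt' [st [st1 st2 stok Eq]]] := IH _ _ w s2T; split; first exact: ltnW.
(* The states of the remaining walk, overwritten up to layer [t] by the starting state. *)
exists (fun j => if (j <= t)%N then s else st j); split.
- by rewrite leqnn.
- by rewrite leqNgt tt'.
- move=> j /andP[]; rewrite leq_eqVlt => /orP[/eqP<- _|tj jt'].
    by rewrite leqnn ltnn st1.
  by rewrite !ifN -?ltnNge ?leqW //; apply: stok; rewrite tj.
rewrite -(subnSK tt') /state_path /= leqnn ltnn st1 Eq; congr (_ :: _).
apply/eq_in_map => j; rewrite mem_iota => /andP[tj _].
by rewrite !ifN -?ltnNge ?leqW.
Qed.

Lemma plength_state_path st : plength (state_path st 0 slots.+1) =
  \sum_(0 <= t < slots) slot_cost t (st t.+1) - sp_beta.
Proof.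
rewrite /plength /state_path big_map -[iota 0 _]/(index_iota 0 slots.+1) big_nat_recr //=.
rewrite /weight /= /step_weight ltnn; congr (_ + _).
by apply: eq_big_nat => t /andP[_ ->].
Qed.

Lemma heads_state_path st t n : [seq head e | e <- state_path st t n] =
  [seq code j (st j) | j <- iota t.+1 n].
Proof.
by rewrite /state_path -map_comp -[t.+1]add1n iotaDl -map_comp; apply: eq_map => j.
Qed.

Definition schedule (st : nat -> nat) : Prop :=
  [/\ st 0%N = 0%N, st slots.+1 = 0%N & state_walk st 0 slots.+1].

(** Simplicity is automatic: vertices of different layers have different codes. *)
Lemma sd_pathP q : is_sd_path layered_graph q <->
  exists2 st, schedule st & q = state_path st 0 slots.+1.
Proof.
split=> [[w _]|[st [st0 stT ok] ->]].
  have [_ [st [st0 stT ok ->]]] := @walk_state_pathP 0 0 q slots.+1 0 w (leq0n _) (leq0n _).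
  by exists st; rewrite ?subn0.
have stB j : (j <= slots.+1)%N -> (st j <= slots)%N.
  by move/(state_bound st0 ok)/andP => [].
split.
  by have := @walk_state_path st 0 slots.+1 stB ok (leqnn _); rewrite add0n stT st0.
rewrite heads_state_path.
have -> : source layered_graph :: [seq code j (st j) | j <- iota 1 slots.+1] =
          [seq code j (st j) | j <- iota 0 slots.+2] by rewrite /= st0.
rewrite map_inj_in_uniq ?iota_uniq // => i j; rewrite !mem_iota !add0n => iT jT.
by case/code_inj; rewrite ?stB.
Qed.
End LayeredGraph.

(** * Schedules and feasible solutions of SP_f *)

Section Correspondence.
Local Open Scope ring_scope.
Variables (D : caching_data) (f : 'I_(F D)).
Let z := sp_data f.

Lemma slots_sp_data : slots z = T D.
Proof. by rewrite /slots /sp_requests /= size_map size_iota. Qed.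

Definition encodes (st : nat -> nat) (x : nat -> rat) (a : nat -> nat -> rat) : Prop :=
  forall t, (1 <= t <= T D)%N ->
    [/\ (st t <= t)%N, x t = (st t != 0%N)%:R &
        forall i, (i < t)%N -> a t i = (st t == i.+1)%:R].

(** Collapses a sum over AoIs to the term of the current state: from [j = 0] in the constraint
    [one_age], from [j = 1] in the age costs. *)
Lemma sum_eqS (g : nat -> rat) (j t s : nat) :
  \sum_(j <= i < t) g i * (s == i.+1)%:R = if (j < s <= t)%N then g s.-1 else 0.
Proof.
case: s => [|s] /=; first by rewrite big1 // => i _; rewrite mulr0.
case: ifP => [|out].
  rewrite ltnS => jst; rewrite (bigD1_seq s) ?mem_index_iota ?iota_uniq //= eqxx mulr1.
  by rewrite big1 ?addr0 // => i /negbTE; rewrite eqSS eq_sym => ->; rewrite mulr0.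
rewrite big_nat big1 // => i ji; rewrite eqSS; case: eqVneq => [si|]; last by rewrite mulr0.
by move: out; rewrite ltnS si ji.
Qed.

Lemma nth_map_iota (R : Type) (d : R) (g : nat -> R) i n k :
  (k < n)%N -> nth d [seq g j | j <- iota i n] k = g (i + k)%N.
Proof. by move=> kn; rewrite (nth_map 0%N) ?size_iota // nth_iota. Qed.

Lemma objective_encodes st x a : encodes st x a ->
  objective f x a = \sum_(0 <= t < slots z) slot_cost z t (st t.+1) - beta_star f.
Proof.
move=> enc; rewrite /objective /total_cost mulr_sumr -!big_split -sumrB /=; congr (_ - _).
rewrite big_add1 /= slots_sp_data; apply: eq_big_nat => t /= tT.
have [sT -> Ha] := enc t.+1 tT; rewrite Ha //.
rewrite (eq_big_nat _ _ (F2 := fun i =>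
  (p f i * (m t.+1 f)%:R) * (st t.+1 == i.+1)%:R)) => [|i /andP[_ it]]; last by rewrite Ha.
rewrite sum_eqS /slot_cost /z /= /sp_requests /sp_pi /sp_ages /sp_size /sp_cs /sp_cb /sp_lambda /=.
rewrite !(nth_map_iota _ _ _ tT) !add1n.
case: (st t.+1) sT => [|[|s]] sT /=; rewrite ?sT /=; first ring; first ring.
(* State [s.+2] is AoI [s.+1], whose cost stands at index [s] since the list starts with AoI 1. *)
by rewrite subSS subSS subn0 nth_map_iota ?add1n; [ring|lia].
Qed.

Lemma schedule_bound st t : schedule z st -> (t <= (T D).+1)%N ->
  (st t <= t)%N && (st t <= T D)%N.
Proof. by rewrite -slots_sp_data => -[st0 _ ok]; apply: state_bound. Qed.

(** The bound in [ageing] is positive only if the content is cached with positive AoI and had AoI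
    [i - 1] in the slot before; [step_ok] then makes the AoI equal to [i]. [no_jump] is the same
    rule read backwards. *)
Lemma schedule_feasible st x a : schedule z st -> encodes st x a -> feasible D x a.
Proof.
move=> sch enc; have [_ _ ok] := sch.
have prev t : (2 <= t <= T D)%N -> (st t <= 1)%N || (0 < st t.-1)%N && (st t == (st t.-1).+1).
  case: t => // t /andP[t2 tT]; have := ok t; rewrite slots_sp_data => /(_ _)/andP[] //; lia.
split.
- move=> t tT; have [sT -> Ha] := enc t tT.
  rewrite (eq_big_nat _ _ (F2 := fun i => 1 * (st t == i.+1)%:R)); last first.
    by move=> i /andP[_ it]; rewrite Ha // mul1r.
  by rewrite sum_eqS sT andbT lt0n; case: (st t == 0%N).
- move=> t i tT it; have t1 : (1 <= t <= T D)%N by lia.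
  have t2 : (1 <= t.-1 <= T D)%N by lia.
  have [_ -> Ha] := enc t t1; have [_ _ Hb] := enc _ t2.
  rewrite !Ha ?Hb; try lia; have := prev t tT.
  case: (st t) => [|[|s]] //=; rewrite ?eqSS.
  + by case: (_ == _).
  + by case: (_ == _) => //; case: (_ == _).
  + move=> /andP[_ /eqP[<-]]; have -> : i.-1.+1 = i by lia.
    by case: (_ == _).
- move=> t i tT it; have t1 : (1 <= t <= T D)%N by lia.
  have t2 : (1 <= t.-1 <= T D)%N by lia.
  have [_ _ Ha] := enc t t1; have [_ _ Hb] := enc _ t2.
  rewrite Ha ?Hb; try lia; have := prev t tT.
  case: (eqVneq (st t) i.+1) => [->|_ _]; last by case: (_ == _).
  have -> : i.-1.+1 = i by lia.
  by rewrite eqSS ltnNge (proj1 (andP it)) eq_sym => /andP[_ ->].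
- by move=> t tT; have [_ -> _] := enc t tT; case: (_ != _); [right|left].
- move=> t i tT it; have [_ _ Ha] := enc t tT; rewrite Ha; last lia.
  by case: (_ == _); [right|left].
Qed.

(** On a row with at most one 1, the sum is the position of that 1 shifted by one, and [0] on a zero
    row. The default [0] outside the slots gives the source and destination layers their prescribed
    state. *)
Definition state_of (a : nat -> nat -> rat) (t : nat) : nat :=
  if (1 <= t <= T D)%N then (\sum_(0 <= i < t) (if a t i == 1%R then i.+1 else 0))%N else 0%N.

(** The sum is at most 1. Once one entry equals 1, the others are nonnegative with sum 0, so they
    vanish. *)
Lemma one_hot (a : nat -> rat) (x : rat) n : (forall i, (i < n)%N -> binary (a i)) ->
  binary x -> \sum_(0 <= i < n) a i = x ->
  exists s, [/\ (s <= n)%N, x = (s != 0%N)%:R & forall i, (i < n)%N -> a i = (s == i.+1)%:R].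
Proof.
move=> Ha Hx; rewrite big_mkord => sumx.
have a_ge0 (i : 'I_n) : 0 <= a i by case: (Ha i (ltn_ord i)) => ->.
case: (pickP (fun i : 'I_n => a i == 1)) => [k /eqP ak|none].
  move: sumx; rewrite (bigD1 k) //= ak => sumx.
  have rest_ge0 : 0 <= \sum_(i < n | i != k) a i by apply: sumr_ge0.
  have x1 : x = 1 by case: Hx => // x0; move: sumx; rewrite x0; lra.
  have rest0 : \sum_(i < n | i != k) a i = 0 by move: sumx; rewrite x1; lra.
  exists k.+1; split=> // i ilt; rewrite eqSS; case: eqVneq => [<-//|ki].
  move/(psumr_eq0P (fun j _ => a_ge0 j)): rest0 => /(_ (Ordinal ilt)); apply.
  by apply: contraNneq ki => <-.
exists 0%N; split=> //.
  rewrite -sumx big1 // => i _; case: (Ha i (ltn_ord i)) => // ai.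
  by have := none i; rewrite ai eqxx.
move=> i ilt; case: (Ha i ilt) => // ai.
by have := none (Ordinal ilt); rewrite /= ai eqxx.
Qed.

Lemma feasible_schedule x a : feasible D x a ->
  exists2 st, schedule z st & encodes st x a.
Proof.
move=> [one _ jump xb ab].
have enc : encodes (state_of a) x a.
  move=> t tT; have [|s [st xs Ha]] := one_hot _ (xb t tT) (one t tT).
    by move=> i it; apply: ab => //; lia.
  suff -> : state_of a t = s by [].
  rewrite /state_of tT (eq_big_nat _ _ (F2 := fun i => (i.+1 * (s == i.+1))%N)).
    rewrite big_mkord; case: s st {xs Ha} => [|s] st.
      by rewrite big1 // => i _; rewrite muln0.
    rewrite (bigD1 (Ordinal st)) //= eqxx muln1 big1 ?addn0 // => i.
    by rewrite -val_eqE /= eqSS eq_sym => /negbTE ->; rewrite muln0.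
  move=> i /andP[_ it]; rewrite Ha //; case: (s == i.+1); first by rewrite eqxx muln1.
  by rewrite muln0.
exists (state_of a) => //; split=> //; rewrite slots_sp_data; first by rewrite /state_of ltnn andbF.
move=> t /andP[_ tT]; rewrite /step_ok /= slots_sp_data.
case: (ltnP t (T D)) => [tlt|tge] /=; last first.
  have -> : state_of a t.+1 = 0%N by rewrite /state_of (_ : (_ <= _ <= _)%N = false) //; lia.
  by [].
rewrite andbT; have [st1 _ Ha] := enc t.+1 tlt.
case: (leqP (state_of a t.+1) 1) => //= s2.
have t1 : (1 <= t <= T D)%N by lia.
have [stt _ Hb] := enc t t1.
set s := state_of a t.+1 in st1 Ha s2 *.
(* AoI [s.-1] in slot [t.+1] is positive, so [no_jump] forces AoI [s - 2], which is state [s.-1], in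
   slot [t]. *)
have := jump t.+1 s.-1; rewrite Ha ?Hb /=; try lia.
rewrite !prednK ?eqxx //; try lia.
case: eqVneq => [->|_]; last by move/(_ _ _); rewrite ler10; lia.
by move=> _; rewrite prednK; lia.
Qed.

(** Each layer is visited exactly once and [code] is injective, so testing whether [code t s] is
    visited amounts to testing [st t = s]. *)
Lemma encodes_read_path st : schedule z st ->
  encodes st (sol_x (read_path z (state_path z st 0 (slots z).+1)))
             (sol_a (read_path z (state_path z st 0 (slots z).+1))).
Proof.
move=> sch t tT; have /andP[stt stT] := schedule_bound sch (leqW (proj2 (andP tT))).
have mem s : (s <= T D)%N ->
    (code z t s \in [seq head e | e <- state_path z st 0 (slots z).+1]) = (st t == s).
  move=> sT; rewrite heads_state_path; apply/mapP/eqP => [[j]|<-].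
    rewrite mem_iota slots_sp_data => jT /code_inj []; rewrite ?slots_sp_data //.
      by have /andP[] : (st j <= j)%N && (st j <= T D)%N by apply: schedule_bound => //; lia.
    by move=> -> ->.
  by exists t => //; rewrite mem_iota slots_sp_data; lia.
move: (state_path z st 0 (slots z).+1) mem => q mem.
case: t tT stt stT mem => // t tT stt stT mem.
split=> //.
  rewrite /sol_x /read_path /= nth_map_iota ?slots_sp_data // mem //.
  by case: (_ == _).
move=> i it; rewrite /sol_a /read_path /= nth_map_iota ?slots_sp_data // add0n.
have -> : [seq i <- iota 0 (T D) | (i <= t)%N] = iota 0 t.+1.
  by rewrite -(filter_iota_ltn 0 tT); apply: eq_filter => k.
rewrite nth_map_iota // mem; last by lia.
by case: (_ == _).
Qed.

End Correspondence.

(** * The algorithms *)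

Definition SpSize : prog sp_ty TRat := Fst <<< Fst <<< Fst <<< Fst <<< Fst <<< Fst.
Definition SpRequests : prog sp_ty (TList TNat) :=
  Snd <<< Fst <<< Fst <<< Fst <<< Fst <<< Fst.
Definition SpCs : prog sp_ty TRat := Fst <<< Snd <<< Fst <<< Fst <<< Fst <<< Fst.
Definition SpCb : prog sp_ty TRat := Snd <<< Snd <<< Fst <<< Fst <<< Fst <<< Fst.
Definition SpAges : prog sp_ty (TList TRat) := Snd <<< Fst <<< Fst <<< Fst.
Definition SpLambda : prog sp_ty TRat := Snd <<< Fst <<< Fst.
Definition SpPi : prog sp_ty (TList TRat) := Snd <<< Fst.
Definition SpBeta : prog sp_ty TRat := Snd.

Definition Slots : prog sp_ty TNat := locked (@Size TNat <<< SpRequests).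
Lemma run_Slots z : run Slots z = slots z.
Proof. by rewrite /Slots -lock runE run_Size. Qed.
Lemma pt_Slots : ptime Slots. Proof. by rewrite /Slots -lock /SpRequests; ptime. Qed.
#[local] Hint Resolve pt_Slots : ptime.

Definition Code : prog (TProd sp_ty (TProd TNat TNat)) TNat :=
  locked (NAdd (NMul (Fst <<< Snd) (NAdd (Slots <<< Fst) (NatC 1))) (Snd <<< Snd)).
Lemma run_Code (z : den sp_ty) (t s : nat) : run Code (z, (t, s)) = code z t s.
Proof. by rewrite /Code -lock !runE /= run_Slots addn1. Qed.
Lemma pt_Code : ptime Code. Proof. by rewrite /Code -lock; ptime. Qed.
#[local] Hint Resolve pt_Code : ptime.

Definition SlotCost : prog (TProd sp_ty (TProd TNat TNat)) TRat :=
  let t := Fst <<< Snd in let s := Snd <<< Snd in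
  let l := SpSize <<< Fst in
  let m := RNat (@Nth TNat 0 <<< <(SpRequests <<< Fst, t)>) in
  locked (If (Eqn s (NatC 0)) (RMul (RMul l m) (SpCs <<< Fst))
    (RAdd (RAdd (RMul (RMul l m) (SpCb <<< Fst))
                (ROpp (RMul l (@Nth TRat 0%R <<< <(SpPi <<< Fst, t)>))))
      (If (Eqn s (NatC 1)) (RMul l (RAdd (SpCs <<< Fst) (ROpp (SpCb <<< Fst))))
        (RMul (SpLambda <<< Fst)
          (RMul (@Nth TRat 0%R <<< <(SpAges <<< Fst, NSub s (NatC 2))>) m))))).
Lemma run_SlotCost (z : den sp_ty) (t s : nat) :
  run SlotCost (z, (t, s)) = slot_cost z t s.
Proof.
rewrite /SlotCost -lock run_If holds_Eqn !runE run_If holds_Eqn !runE /=.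
by rewrite !run_Nth.
Qed.
Lemma pt_SlotCost : ptime SlotCost. Proof. by rewrite /SlotCost -lock; ptime. Qed.
#[local] Hint Resolve pt_SlotCost : ptime.

Definition StepWeight : prog (TProd sp_ty (TProd TNat TNat)) TRat :=
  locked (If (Not (Leq (Slots <<< Fst) (Fst <<< Snd))) SlotCost (ROpp (SpBeta <<< Fst))).
Lemma run_StepWeight (z : den sp_ty) (t s : nat) :
  run StepWeight (z, (t, s)) = step_weight z t s.
Proof.
rewrite /StepWeight -lock run_If holds_Not holds_Leq !runE /= run_Slots run_SlotCost.
by rewrite -ltnNge.
Qed.
Lemma pt_StepWeight : ptime StepWeight. Proof. by rewrite /StepWeight -lock; ptime. Qed.
#[local] Hint Resolve pt_StepWeight : ptime.

Definition step_ty := TProd TNat (TProd TNat TNat).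

Definition StepOk : prog (TProd sp_ty step_ty) TBool :=
  let t := Fst <<< Snd in let s := Fst <<< Snd <<< Snd in let s' := Snd <<< Snd <<< Snd in
  locked (And (Or (Leq s' (NatC 1)) (And (Leq (NatC 1) s) (Eqn s' (NAdd s (NatC 1)))))
              (Or (Not (Leq (Slots <<< Fst) t)) (Eqn s' (NatC 0)))).
Lemma holds_StepOk (z : den sp_ty) (c : nat * (nat * nat)) :
  holds (run StepOk (z, c)) = step_ok z c.
Proof. by rewrite /StepOk -lock !holdsE !runE /= run_Slots addn1 -ltnNge. Qed.
Lemma pt_StepOk : ptime StepOk. Proof. by rewrite /StepOk -lock; ptime. Qed.
#[local] Hint Resolve pt_StepOk : ptime.

Definition StepArc : prog (TProd sp_ty step_ty) arc_ty :=
  let z := Fst in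
  let t := Fst <<< Snd in let s := Fst <<< Snd <<< Snd in let s' := Snd <<< Snd <<< Snd in
  locked <(<(Code <<< <(z, <(t, s)>)>, Code <<< <(z, <(NAdd t (NatC 1), s')>)>)>,
           StepWeight <<< <(z, <(t, s')>)>)>.
Lemma run_StepArc (z : den sp_ty) (c : nat * (nat * nat)) :
  run StepArc (z, c) = step_arc z c.
Proof. by rewrite /StepArc -lock !runE /= !run_Code run_StepWeight addn1. Qed.
Lemma pt_StepArc : ptime StepArc. Proof. by rewrite /StepArc -lock; ptime. Qed.
#[local] Hint Resolve pt_StepArc : ptime.

(** Only the length of the auxiliary list matters: one dummy entry in front of the requests yields
    the indices up to [slots], and two of them, in [Vertices], those up to [slots.+1]. *)
Definition States : prog sp_ty (TList TNat) :=
  locked (@Indices TNat <<< Cons <<< <(NatC 0, SpRequests)>).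
Lemma run_States z : run States z = states z.
Proof. by rewrite /States -lock !runE run_Indices. Qed.
Lemma pt_States : ptime States. Proof. by rewrite /States -lock; ptime. Qed.
#[local] Hint Resolve pt_States : ptime.

Definition Vertices : prog sp_ty (TList TNat) :=
  locked (Map Code <<< <(Id, @Pairs TNat TNat <<<
    <(@Indices TNat <<< Cons <<< <(NatC 0, Cons <<< <(NatC 0, SpRequests)>)>, States)>)>).
Lemma run_Vertices z : run Vertices z = vertices (layered_graph z).
Proof.
rewrite /Vertices -lock !runE run_Indices run_States run_Pairs run_Map.
by apply: eq_map => -[t s]; rewrite run_Code.
Qed.
Lemma pt_Vertices : ptime Vertices. Proof. by rewrite /Vertices -lock; ptime. Qed.
#[local] Hint Resolve pt_Vertices : ptime.

Definition Arcs : prog sp_ty (TList arc_ty) :=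
  locked (Map StepArc <<< <(Id, Filter StepOk <<< <(Id,
    @Pairs TNat (TProd TNat TNat) <<< <(States, @Pairs TNat TNat <<< <(States, States)>)>)>)>).
Lemma run_Arcs z : run Arcs z = arcs (layered_graph z).
Proof.
rewrite /Arcs -lock !runE run_States !run_Pairs run_Filter run_Map.
rewrite (eq_filter (holds_StepOk z)).
by apply: eq_map => c; rewrite run_StepArc.
Qed.
Lemma pt_Arcs : ptime Arcs. Proof. by rewrite /Arcs -lock; ptime. Qed.
#[local] Hint Resolve pt_Arcs : ptime.

Definition Build : prog sp_ty graph_ty :=
  <(<(Vertices, Arcs)>,
    <(NatC 0, Code <<< <(Id, <(NAdd Slots (NatC 1), NatC 0)>)>)>)>.
Lemma run_Build z : run Build z = layered_graph z.
Proof. by rewrite /Build !runE run_Vertices run_Arcs run_Slots run_Code addn1. Qed.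
Lemma pt_Build : ptime Build. Proof. by rewrite /Build; ptime. Qed.

(** The data, the heads of the path, and a slot counted from 0. *)
Definition env_ty := TProd (TProd sp_ty (TList TNat)) TNat.

Definition ReadX : prog env_ty TRat :=
  If (Mem <<< <(Code <<< <(Fst <<< Fst, <(NAdd Snd (NatC 1), NatC 0)>)>, Snd <<< Fst)>)
    (RatC 0%R) (RatC 1%R).

Definition ReadA : prog (TProd env_ty TNat) TRat :=
  If (Mem <<< <(Code <<< <(Fst <<< Fst <<< Fst,
                           <(NAdd (Snd <<< Fst) (NatC 1), NAdd Snd (NatC 1))>)>,
                Snd <<< Fst <<< Fst)>)
    (RatC 1%R) (RatC 0%R).

Definition ReadRow : prog env_ty (TList TRat) :=
  Map ReadA <<< <(Id, Filter (Leq Snd Fst) <<<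
    <(Snd, @Indices TNat <<< SpRequests <<< Fst <<< Fst)>)>.

Definition ForSlots a (f : prog env_ty a) : prog (TProd sp_ty pathway_ty) (TList a) :=
  Map f <<< <(<(Fst, Heads <<< Snd)>, @Indices TNat <<< SpRequests <<< Fst)>.

Definition Recover : prog (TProd sp_ty pathway_ty) sol_ty :=
  <(ForSlots ReadX, ForSlots ReadRow)>.

Lemma run_Recover z (q : pathway) : run Recover (z, q) = read_path z q.
Proof.
rewrite /Recover /ForSlots !runE /= run_Heads run_Indices !run_Map /read_path; congr pair.
  apply: eq_map => t.
  by rewrite /ReadX run_If !runE /= run_Code holds_Mem addn1.
apply: eq_map => t; rewrite /ReadRow !runE /= run_Indices run_Filter run_Map.
rewrite (@eq_filter _ _ (fun i => i <= t)) => [|i]; last by rewrite holds_Leq.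
by apply: eq_map => i; rewrite /ReadA run_If !runE /= run_Code holds_Mem !addn1.
Qed.
Lemma pt_Recover : ptime Recover.
Proof. by rewrite /Recover /ForSlots /ReadX /ReadRow /ReadA; ptime. Qed.
#[local] Hint Resolve pt_Build pt_Recover : ptime.

(** The constant answer for the missing path is a dummy: by [shortest_layered] a layered graph
    always has a shortest path. *)
Definition Solve : prog sp_ty (TProd sol_ty TRat) :=
  Match (Shortest <<< Build) (@Const _ (TProd sol_ty TRat) (([::], [::]), 0%R))
    <(Recover, Plength <<< Snd)>.
Lemma run_Solve z : run Solve z =
  if shortest (layered_graph z) is inr q then (read_path z q, plength q)
  else (([::], [::]), 0%R).
Proof.
rewrite /Solve /Match run_Comp run_Pair run_Id run_Comp run_Build run_Shortest.
case: (shortest _) => // q.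
by rewrite -run_Recover -run_Plength.
Qed.
Lemma pt_Solve : ptime Solve. Proof. by rewrite /Solve /Match; ptime. Qed.

Lemma polytime_run a b (p : prog a b) : ptime p -> polytime (run p).
Proof. by move=> Hp; exists p. Qed.

Local Open Scope ring_scope.

(** The path of a schedule is as long as the objective of any solution it encodes. As every feasible
    solution is encoded by some schedule, a shortest path bounds all objectives from below, and its
    own solution attains the bound. *)
Lemma shortest_path_optimal (D : caching_data) (f : 'I_(F D)) (q : pathway) :
  let z := sp_data f in is_shortest_path (layered_graph z) q ->
  is_optimal_value f (plength q) /\
  is_optimal f (sol_x (read_path z q)) (sol_a (read_path z q)).
Proof.
move=> z [/sd_pathP[st sch Eq] min].
have enc := encodes_read_path sch; rewrite -Eq in enc.
have feas := schedule_feasible sch enc.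
have obj : objective f (sol_x (read_path z q)) (sol_a (read_path z q)) = plength q.
  by rewrite (objective_encodes f enc) Eq plength_state_path.
have le x a : feasible D x a -> plength q <= objective f x a.
  move=> /(@feasible_schedule _ f)[st' sch' enc'].
  have := min (state_path z st' 0 (slots z).+1).
  rewrite plength_state_path (objective_encodes f enc'); apply.
  by apply/sd_pathP; exists st'.
split; first by split=> //; exists (sol_x (read_path z q)), (sol_a (read_path z q)).
by split=> // x a /le; rewrite obj.
Qed.

(** Never caching the content is always possible; this rules out the answer that no path exists. *)
Lemma empty_schedule z : schedule z (fun=> 0%N).
Proof. by split=> // t; rewrite /step_ok /= orbT. Qed.

Lemma shortest_layered z :
  exists2 q, shortest (layered_graph z) = inr q & is_shortest_path (layered_graph z) q.
Proof.
have := shortest_correct (layered_graphP z) (@layered_graph_acyclic z).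
case: (shortest _) => [u none|q Hq]; last by exists q.
case: (none (state_path z (fun=> 0%N) 0 (slots z).+1)); apply/sd_pathP.
by exists (fun=> 0%N) => //; apply: empty_schedule.
Qed.

Theorem theorem2 :
  exists (build : den sp_ty -> den graph_ty)
         (shortest : den graph_ty -> den (TSum TUnit pathway_ty))
         (recover : den (TProd sp_ty pathway_ty) -> den sol_ty)
         (solve : den sp_ty -> den (TProd sol_ty TRat)),
    [/\ polytime build, polytime shortest, polytime recover & polytime solve]
    /\ solves_shortest_path shortest
    /\ forall (D : caching_data) (f : 'I_(F D)),
         let G : graph := build (sp_data f) in
         [/\ is_graph G /\ no_negative_cycle G,
             exists q : pathway, is_shortest_path G q,
             forall q : pathway, is_shortest_path G q ->
               is_optimal_value f (plength q)
               /\ is_optimal f (sol_x (recover (sp_data f, q)))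
                               (sol_a (recover (sp_data f, q)))
           & is_optimal f (sol_x (solve (sp_data f)).1)
                          (sol_a (solve (sp_data f)).1)
             /\ is_optimal_value f (solve (sp_data f)).2].
Proof.
exists (run Build), (run Shortest), (run Recover), (run Solve); split.
  split; apply: polytime_run;
    [exact: pt_Build|exact: pt_Shortest|exact: pt_Recover|exact: pt_Solve].
split=> [G|D f]; first by rewrite run_Shortest; apply: shortest_correct.
have [q sq Hq] := shortest_layered (sp_data f).
rewrite run_Build run_Solve sq; split.
- by split; [apply: layered_graphP|apply: layered_graph_acyclic].
- by exists q.
- by move=> q' /shortest_path_optimal; rewrite run_Recover.
by have [? ?] := shortest_path_optimal Hq.
Qed.
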